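(* Let $X=(x_{ij})$ be a generic $k\times n$ matrix ($k\le n$), $S=K[x_{ij}]$ with $K$ a field or $\mathbb{Z}$, and let $Z$ be a subset of the variables $x_{ij}$. Let $X'$ be the sparse generic matrix obtained from $X$ by setting the variables in $Z$ equal to $0$, and let $T=S/(Z)$. If $E_\bullet$ is the Eagon–Northcott complex of $X$ with its standard bases, then the pruning $P(E_\bullet,Z)$ is a minimal free resolution of $T/I_k(X')$ as a $T$-module.
   Context: Pruning. Let $C_\bullet$ be a sequence of free $S$-modules with chosen bases $F_t\xrightarrow{A_t}F_{t-1}\to\cdots\to F_1\xrightarrow{A_1}F_0$, so each map is a matrix $A_i$ (columns indexed by the basis of $F_i$, rows by the basis of $F_{i-1}$). The pruning $P(C_\bullet,Z)$ is obtained by the following procedure: for $i=1,2,\dots,t$ in turn, replace the current matrix $A_i$ by the matrix obtained by setting every variable of $Z$ equal to $0$; let $U$ be the set of columns of this new $A_i$ that are identically zero; then delete from $F_i$ the basis elements indexed by $U$, delete from $A_i$ the columns indexed by $U$, and delete from $A_{i+1}$ (if $i<t$) the rows indexed by $U$. The resulting sequence is regarded as a sequence of free $T$-modules and maps, $T=S/(Z)$. Eagon–Northcott complex with standard bases. Let $e_1,\dots,e_k$ be a basis of $S^k$ and $f_1,\dots,f_n$ a basis of $S^n$. Set $E_0=S$; $E_1=\wedge^kS^n$ with basis $f_J=f_{j_1}\wedge\cdots\wedge f_{j_k}$ ($j_1<\cdots<j_k$), and $d(f_J)=\Delta_J$, the determinant of the $k\times k$ submatrix of $X$ on columns $J$.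 For $2\le i\le n-k+1$, $E_i=D_{i-1}(S^k)\otimes\wedge^{k+i-1}S^n$ with basis $e^{(\alpha)}\otimes f_L$, where $\alpha\in\mathbb{N}^k$, $|\alpha|=i-1$, $e^{(\alpha)}=e_1^{(\alpha_1)}\cdots e_k^{(\alpha_k)}$ is a divided power monomial, and $f_L=f_{l_1}\wedge\cdots\wedge f_{l_m}$ for $l_1<\cdots<l_m$, $m=k+i-1$; the differential is $d(e^{(\alpha)}\otimes f_L)=\sum_{r:\alpha_r>0}\sum_{s=1}^m(-1)^{s+1}x_{r l_s}\,e^{(\alpha-\varepsilon_r)}\otimes f_{l_1}\wedge\cdots\widehat{f_{l_s}}\cdots\wedge f_{l_m}$ (with $e^{(0)}\otimes f_{L'}$ identified with $f_{L'}\in E_1$ when $i=2$). The matrices of $E_\bullet$ are taken with respect to these bases. $I_k(X')$ denotes the ideal of maximal minors of $X'$. *)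

(* Defs.v *)
From HB Require Import structures.
From mathcomp Require Import all_boot all_order all_algebra.
Unset Printing Implicit Defensive.
Import Order.TTheory GRing.Theory Num.Theory.
Local Open Scope ring_scope.

Fixpoint mpoly (R : comNzRingType) (m : nat) : comNzRingType :=
  if m is m'.+1 then ({poly (mpoly R m')} : comNzRingType) else R.

(* the variable y_i (i < m); y_{m-1} is the outermost indeterminate *)
Fixpoint mvar (R : comNzRingType) (m : nat) (i : nat) : mpoly R m :=
  match m return mpoly R m with
  | 0 => 0
  | m'.+1 => if i == m' then ('X : {poly mpoly R m'}) else (mvar R m' i)%:P
  end.

Fixpoint zeroVars (R : comNzRingType) (m : nat) (Zv : pred nat) : mpoly R m -> mpoly R m :=
  match m return mpoly R m -> mpoly R m with
  | 0 => id
  | m'.+1 => fun p : {poly mpoly R m'} =>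
      let q := map_poly (zeroVars R m' Zv) p in
      if Zv m' then (q`_0)%:P else q
  end.

Definition S (R : comNzRingType) (k n : nat) := mpoly R (k * n).

Definition genX (R : comNzRingType) (k n : nat) : 'M[S R k n]_(k, n) :=
  \matrix_(r < k, j < n) mvar R (k * n) (r * n + j).

Definition Zidx (k n : nat) (Z : {set 'I_k * 'I_n}) : pred nat :=
  fun i => [exists p in Z, (p.1 * n + p.2)%N == i].

Definition zeroZ (R : comNzRingType) (k n : nat) (Z : {set 'I_k * 'I_n}) :
  S R k n -> S R k n := zeroVars R (k * n) (Zidx k n Z).

(* T = S/(Z), realised as the subring K[x_ij : x_ij not in Z] of S,
   i.e. the image (= fixed points) of the projection zeroZ *)
Definition inT (R : comNzRingType) (k n : nat) (Z : {set 'I_k * 'I_n}) (p : S R k n) : bool :=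
  zeroZ R k n Z p == p.

Definition constTerm (R : comNzRingType) (k n : nat) (p : S R k n) : S R k n :=
  zeroVars R (k * n) predT p.

Definition maxMinor (A : comNzRingType) (k n : nat) (M : 'M[A]_(k, n)) (J : {set 'I_n}) : A :=
  \det (\matrix_(a < k, b < k) nth 0 [seq M a j | j <- enum J] b).

(* A basis element e^(alpha) (x) f_L is encoded as a pair (alpha, L);
   alpha : 'I_k -> 'I_n.+1 is large enough since |alpha| <= n - k. *)
Definition ENbasis (k n : nat) : finType := ({ffun 'I_k -> 'I_n.+1} * {set 'I_n})%type.

(* the unique basis element of E_0 = S *)
Definition ENb0 (k n : nat) : ENbasis k n := ([ffun _ => ord0], set0).

Definition inENbasis (k n : nat) (i : nat) (b : ENbasis k n) : bool :=
  if i is i'.+1 then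
    ((\sum_(r < k) (val (b.1 r)))%N == i') && (#|b.2| == k + i')%N
  else b == ENb0 k n.

(* matrix entry of d : E_i -> E_{i-1} (i >= 1): coefficient of the row basis
   element b' in d(b) for the column basis element b. *)
Definition ENentry (R : comNzRingType) (k n : nat) (i : nat) (b' b : ENbasis k n) : S R k n :=
  match i with
  | 0 => 0
  | 1 => maxMinor (S R k n) k n (genX R k n) b.2
  | _ => \sum_(r < k | (0 < val (b.1 r))%N) \sum_(l in b.2)
           (if [forall j, val (b'.1 j) == (val (b.1 j) - (j == r))%N] && (b'.2 == b.2 :\ l)
            then (-1) ^+ #|[set l' in b.2 | (l' < l)%N]| * genX R k n r l
            else 0)
  end.

Fixpoint pruneSurv (R : comNzRingType) (k n : nat) (Z : {set 'I_k * 'I_n}) (i : nat)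
  : {set ENbasis k n} :=
  if i is i'.+1 then
    [set c | inENbasis k n i c &&
       [exists r, (r \in pruneSurv R k n Z i') && (zeroZ R k n Z (ENentry R k n i r c) != 0)]]
  else [set ENb0 k n].

Definition prunedEntry (R : comNzRingType) (k n : nat) (Z : {set 'I_k * 'I_n}) (i : nat)
  (r c : ENbasis k n) : S R k n := zeroZ R k n Z (ENentry R k n i r c).

(* an element of the free T-module F_i (coordinates indexed by surviving basis
   elements; coordinates outside pruneSurv i are ignored) *)
Definition vecT (R : comNzRingType) (k n : nat) (Z : {set 'I_k * 'I_n})
  (v : ENbasis k n -> S R k n) : Prop := forall c, inT R k n Z (v c).

Definition prunedApply (R : comNzRingType) (k n : nat) (Z : {set 'I_k * 'I_n}) (i : nat)
  (v : ENbasis k n -> S R k n) (r : ENbasis k n) : S R k n :=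
  \sum_(c in pruneSurv R k n Z i) prunedEntry R k n Z i r c * v c.

Definition prunedENisMinRes (R : comNzRingType) (k n : nat) (Z : {set 'I_k * 'I_n}) : Prop :=
  let t := (n - k).+1 in
  let Surv := pruneSurv R k n Z in
  let X' := map_mx (zeroZ R k n Z) (genX R k n) in
  (forall i : nat, (1 <= i < t)%N ->
     forall v, vecT R k n Z v ->
       ((forall r, r \in Surv (i.-1) -> prunedApply R k n Z i v r = 0) <->
        (exists w, vecT R k n Z w /\
           forall c, c \in Surv i -> prunedApply R k n Z i.+1 w c = v c)))
  /\ (forall v, vecT R k n Z v ->
        (forall r, r \in Surv (t.-1) -> prunedApply R k n Z t v r = 0) ->
        forall c, c \in Surv t -> v c = 0)
  /\ (forall p, inT R k n Z p ->
        ((exists w, vecT R k n Z w /\ prunedApply R k n Z 1 w (ENb0 k n) = p) <->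
         (exists cf : {set 'I_n} -> S R k n, (forall J, inT R k n Z (cf J)) /\
            p = \sum_(J : {set 'I_n} | #|J| == k) cf J * maxMinor (S R k n) k n X' J)))
  (* minimality: all entries of the differentials lie in the ideal of the variables *)
  /\ (forall i : nat, (1 <= i <= t)%N ->
        forall r c, r \in Surv (i.-1) -> c \in Surv i ->
          constTerm R k n (prunedEntry R k n Z i r c) = 0).

(* Main.v *)
(** Pruning amounts to keeping the basis elements (alpha, L) whose multidegree
   supports a matching: a set of edges (r, l) outside Z covering each column of L
   once and each row r exactly alpha_r + 1 times.

   Give the variables generic weights.  Every surviving (alpha, L) then has a
   unique matching F of least weight, and F is optimal exactly when potentials u
   on the rows put each edge of F strictly inside a "tropical sector" [sec u].
   A pair (monomial f, basis element with optimal matching F) is regarded as a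
   cell F over the monomial m = f * F; up to terms of smaller weight, the
   differential only deletes edges of F, so over a fixed m one has a complex of
   products of simplices.  Each cell F has a least potential [pot F], computed by
   longest paths.  Genericity makes the cells with a given least potential u an
   interval of edge sets (apart from rows having to be nonempty), and switching a
   removable edge matches these cells in pairs.  Exactly one cell over m may stay
   unmatched; it is a vertex and is paired with m itself in degree 0, through the
   leading term of a maximal minor.  The pairing is acyclic for the rank
   (weight of m, sum of potentials, first active row), so elimination along it
   proves exactness over any commutative ring. *)

From HB Require Import structures.
From mathcomp Require Import all_boot all_order all_fingroup all_algebra.
From mathcomp Require Import zify.
Require Import Defs.
Set Implicit Arguments.
Unset Strict Implicit.
Unset Printing Implicit Defensive.
Import Order.TTheory GRing.Theory Num.Theory.

(** * Generic weights and optimal matchings *)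

(** Two facts about the pairing suffice, and no homotopy is built: a cycle with no coefficient at
    the lower member of any pair is zero, and every vector acquires this shape after subtracting a
    boundary. The first is an induction upwards on the rank. The second removes lower coefficients
    at the price of new ones whose partners have larger rank; it stops because ranks are bounded in
    each polynomial degree. No division occurs, since the entry between paired elements is a
    variable up to sign. The delicate point is that an edge must be switchable regardless of the
    other edges of the cell. Genericity provides this: a longest path is unique, so whether an edge
    matters for the least potential can be tested once, in the largest edge set with that potential.
    Above degree 1 unmatched cells are excluded by counting: they have one edge in each row, hence
    [k] edges, whereas degree [i] requires [k + i - 1]. Uniqueness of the unmatched cell is thus
    needed only in degree 1. *)

Lemma binary_sum_inj (N : nat) (b c : nat -> bool) :
  \sum_(i < N) b i * 2 ^ i = \sum_(i < N) c i * 2 ^ i ->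
  forall i, i < N -> b i = c i.
Proof.
elim: N b c => [|N IH] b c //.
rewrite !big_ord_recl /= !expn0 !muln1.
have E (d : nat -> bool) : \sum_(i < N) d (bump 0 i) * 2 ^ bump 0 i =
    2 * \sum_(i < N) d i.+1 * 2 ^ i.
  by rewrite big_distrr; apply: eq_bigr => i _ /=; rewrite /bump add1n expnS; lia.
rewrite !E => H.
have H0 : b 0 = c 0 by move: H; case: (b 0); case: (c 0); lia.
have H1 : \sum_(i < N) b i.+1 * 2 ^ i = \sum_(i < N) c i.+1 * 2 ^ i.
  by move: H; rewrite H0; lia.
by case=> [|i] // /(IH (fun i => b i.+1) (fun i => c i.+1) H1).
Qed.

Section Matchings.

Variables (k n : nat) (G : {set 'I_k * 'I_n}).

Local Notation edge := ('I_k * 'I_n)%type.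

Definition eidx (p : edge) : nat := p.1 * n + p.2.

Lemma eidx_inj : injective eidx.
Proof.
move=> [r l] [s j]; rewrite /eidx /= => H.
have lt_l := ltn_ord l; have lt_j := ltn_ord j.
have n0 : 0 < n by lia.
have rs : r = s :> nat.
  by move: (congr1 (divn^~ n) H); rewrite !divnMDl // !divn_small // !addn0.
have lj : l = j :> nat by move: H; rewrite rs; lia.
by rewrite (ord_inj rs) (ord_inj lj).
Qed.

Lemma eidx_lt (p : edge) : eidx p < k * n.
Proof.
rewrite /eidx; have := ltn_ord p.1; have := ltn_ord p.2; nia.
Qed.

Lemma eidx_surj (i : nat) : i < k * n -> exists p, eidx p = i.
Proof.
move=> ltin; have n0 : 0 < n by lia.
have lt1 : i %/ n < k by rewrite ltn_divLR.
have lt2 : i %% n < n by rewrite ltn_mod.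
by exists (Ordinal lt1, Ordinal lt2); rewrite /eidx /= -divn_eq.
Qed.

(* The factor k + 1 exceeds the length of every simple path, so that the
   unit slack collected along a path never interferes with genericity. *)
Definition wgt (p : edge) : nat := k.+1 * 2 ^ eidx p.

Lemma bin_set_inj (A B : {set edge}) :
  \sum_(p in A) 2 ^ eidx p = \sum_(p in B) 2 ^ eidx p -> A = B.
Proof.
pose ch (A : {set edge}) (i : nat) := [exists p in A, eidx p == i].
have chE C p : ch C (eidx p) = (p \in C).
  apply/existsP/idP => [[q /andP[qC /eqP/eidx_inj <-]] //|pC].
  by exists p; rewrite pC eqxx.
have E (C : {set edge}) : \sum_(p in C) 2 ^ eidx p = \sum_(i < k * n) ch C i * 2 ^ i.
  rewrite big_mkcond /=.
  pose h p : 'I_(k * n) := Ordinal (eidx_lt p).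
  rewrite (reindex h) /=; last first.
    apply: onW_bij; apply: inj_card_bij.
      by move=> p q /(congr1 val) /= /eidx_inj.
    by rewrite card_prod !card_ord.
  by apply: eq_bigr => p _; rewrite chE; case: (p \in C); rewrite ?mul1n ?mul0n.
rewrite !E => /binary_sum_inj H; apply/setP => p.
by rewrite -!chE H // eidx_lt.
Qed.

Lemma wgt_sum (A : {set edge}) :
  \sum_(p in A) wgt p = k.+1 * \sum_(p in A) 2 ^ eidx p.
Proof. by rewrite big_distrr. Qed.

(** Integer division by [k.+1] removes the slacks [a] and [b], which will be lengths of simple
    paths, and leaves two binary expansions to compare. *)
Lemma wgt_generic (A B : {set edge}) (a b : nat) : a <= k -> b <= k ->
  \sum_(p in A) wgt p + a = \sum_(p in B) wgt p + b -> A = B.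
Proof.
rewrite !wgt_sum => ak bk H; apply: bin_set_inj.
move: (\sum_(p in A) _) (\sum_(p in B) _) H => x y H.
have /(congr1 (divn^~ k.+1)) := H.
by rewrite /= [_ * x]mulnC [_ * y]mulnC !divnMDl // !divn_small ?ltnS // !addn0.
Qed.

(** Both sums are multiples of [k.+1], so the gap exceeds the slack of any path with at most [k]
    steps, even a closed one through all rows. *)
Lemma wgt_gap (A B : {set edge}) : A != B ->
  \sum_(p in A) wgt p <= \sum_(p in B) wgt p ->
  \sum_(p in A) wgt p + k.+1 <= \sum_(p in B) wgt p.
Proof.
rewrite !wgt_sum => neq; have := @bin_set_inj A B.
move: (\sum_(p in A) _) (\sum_(p in B) _) => x y H le.
have : x <> y by move=> /H /eqP; apply/negP.
nia.
Qed.

Definition erow (F : {set edge}) (r : 'I_k) : {set edge} := [set p in F | p.1 == r].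
Definition ecol (F : {set edge}) (l : 'I_n) : {set edge} := [set p in F | p.2 == l].

Definition cost (F : {set edge}) : nat := \sum_(p in F) wgt p.

Definition isMat (F : {set edge}) (c : ENbasis k n) : bool :=
  [&& F \subset G, [forall r, #|erow F r| == (c.1 r).+1]
    & [forall l, #|ecol F l| == (l \in c.2)]].

Lemma isMatP (F : {set edge}) (c : ENbasis k n) :
  reflect [/\ F \subset G, forall r, #|erow F r| = (c.1 r).+1
  & forall l, #|ecol F l| = (l \in c.2)] (isMat F c).
Proof.
apply: (iffP and3P) => [[? /forallP H1 /forallP H2]|[? H1 H2]].
  by split=> // x; apply/eqP.
by split=> //; apply/forallP => x; apply/eqP.
Qed.

(** Edge [(r, l)] is kept when [r] is the strict minimiser of [wgt (s, l) - u s] over the rows [s]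
    with [(s, l)] in [G]; a column thus contributes at most one edge. The additive form avoids
    truncated subtraction. *)
Definition sec (u : 'I_k -> nat) : {set edge} :=
  [set p in G | [forall s, (s != p.1) ==> ((s, p.2) \in G) ==>
     (u s + wgt p < u p.1 + wgt (s, p.2))]].

Lemma secP u (r : 'I_k) (l : 'I_n) : reflect
  ((r, l) \in G /\ forall s : 'I_k, s != r -> (s, l) \in G -> u s + wgt (r, l) < u r + wgt (s, l))
  ((r, l) \in sec u).
Proof.
rewrite inE /=; apply: (iffP andP) => -[-> H]; split=> //.
  by move=> s sr sG; move/forallP/(_ s): H; rewrite sr sG.
by apply/forallP => s; apply/implyP => sr; apply/implyP => sG; apply: H.
Qed.

Lemma sec_col_inj u (r s : 'I_k) (l : 'I_n) : (r, l) \in sec u -> (s, l) \in sec u -> r = s.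
Proof.
move=> /secP[rG Hr] /secP[sG Hs]; apply/eqP; apply/negPn/negP => neq.
have := Hr s; rewrite eq_sym neq => /(_ isT sG).
have := Hs r neq rG; lia.
Qed.

Lemma sec_sub u : sec u \subset G.
Proof. by apply/subsetP => p; rewrite inE => /andP[]. Qed.

Lemma sum_edge (F : {set edge}) (g : edge -> nat) :
  \sum_(p in F) g p = \sum_l \sum_(p in ecol F l) g p.
Proof.
rewrite (partition_big (fun p : edge => p.2) predT) //=.
by apply: eq_bigr => l _; apply: eq_bigl => p; rewrite inE.
Qed.

Lemma sum_edge_row (F : {set edge}) (u : 'I_k -> nat) :
  \sum_(p in F) u p.1 = \sum_r #|erow F r| * u r.
Proof.
rewrite (partition_big (fun p : edge => p.1) predT) //=.
apply: eq_bigr => r _.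
rewrite -sum_nat_const; apply: eq_big => [p|p /andP[_ /eqP->] //].
by rewrite inE.
Qed.

Lemma isMat_col1 (F : {set edge}) (c : ENbasis k n) r s l :
  isMat F c -> (r, l) \in F -> (s, l) \in F -> r = s.
Proof.
move=> /isMatP[_ _ /(_ l) H] rF sF.
have : #|ecol F l| <= 1 by rewrite H leq_b1.
move/card_le1_eqP => /(_ (r, l) (s, l)); rewrite !inE rF sF !eqxx.
by move=> /(_ isT isT) [].
Qed.

(* Summing the defining inequalities of the sectors over the columns, the
   potentials cancel because both matchings have the same row sizes. *)
Lemma sec_min_cost u (F F' : {set edge}) (c : ENbasis k n) :
  isMat F c -> F \subset sec u -> isMat F' c ->
  cost F <= cost F' ?= iff (F' == F).
Proof.
move=> mF sF mF'.
(* The boolean adds one for each column where the matchings differ, which yields the equality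
   case. *)
have col_le l : \sum_(p in ecol F l) wgt p + \sum_(p in ecol F' l) u p.1 +
    (ecol F l != ecol F' l) <=
  \sum_(p in ecol F' l) wgt p + \sum_(p in ecol F l) u p.1.
  have /isMatP[_ _ /(_ l) H] := mF; have /isMatP[sG' _ /(_ l) H'] := mF'.
  case lc: (l \in c.2) H H'; last first.
    by move=> /eqP; rewrite cards_eq0 => /eqP-> /eqP; rewrite cards_eq0 => /eqP->;
       rewrite !big_set0 eqxx.
  move=> /eqP/cards1P[[r j] E] /eqP/cards1P[[s j'] E'].
  have : (r, j) \in ecol F l by rewrite E set11.
  rewrite !inE /= => /andP[rF /eqP jl]; rewrite {}jl in E rF.
  have : (s, j') \in ecol F' l by rewrite E' set11.
  rewrite !inE /= => /andP[sF' /eqP jl]; rewrite {}jl in E' sF'.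
  rewrite E E' !big_set1 /=.
  have [->|neq] := eqVneq s r; first by rewrite eqxx addn0 addnC.
  have /secP[_ /(_ s neq (subsetP sG' _ sF'))] := subsetP sF _ rF; lia.
have usum (H : {set edge}) : isMat H c -> \sum_(p in H) u p.1 = \sum_r (c.1 r).+1 * u r.
  by move=> /isMatP[_ Hr _]; rewrite sum_edge_row; apply: eq_bigr => r _; rewrite Hr.
have le : cost F + \sum_l (ecol F l != ecol F' l) <= cost F'.
  rewrite -(leq_add2r (\sum_(p in F) u p.1)) {1}(usum F) // -(usum F') //.
  rewrite /cost !sum_edge -addnA [X in _ + X]addnC addnA -!big_split /=.
  exact: leq_sum.
have [eqF|neqF] := eqVneq F' F; first by rewrite eqF; split; rewrite ?eqxx.
split; first by lia.
apply/eqP => eqc; move: neqF; rewrite -[_ != _]negbK => /negP; apply; apply/negPn.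
have /eqP : \sum_l (ecol F l != ecol F' l) = 0 by lia.
rewrite sum_nat_eq0 => /forallP H.
apply/eqP/setP => -[r l]; have := H l; rewrite eqb0 negbK => /eqP/setP/(_ (r, l)).
by rewrite !inE eqxx !andbT.
Qed.

End Matchings.

(** * Least potentials *)

Section Potentials.

Variables (k n : nat) (G : {set 'I_k * 'I_n}).

Local Notation edge := ('I_k * 'I_n)%type.
Implicit Types (F : {set edge}) (r s : 'I_k) (l : 'I_n) (u : 'I_k -> nat).
Implicit Types (p : seq ('I_n * 'I_k)).

(** [F \subset sec G u] is a system of difference constraints
    [u r >= u s + wgt (r, l) + 1 - wgt (s, l)]. In its constraint graph on the rows, a step leaves
    [r] by an edge of [F] and enters another row by an edge of [G] in the same column. *)
Fixpoint isPath F r p : bool :=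
  if p is x :: p' then [&& (r, x.1) \in F, (x.2, x.1) \in G, x.2 != r & isPath F x.2 p']
  else true.

Definition rows r p : seq 'I_k := r :: map snd p.

(** The successor turns the strict sector inequality into a weak one over the integers. *)
Fixpoint pathWgt r p : int :=
  if p is x :: p' then
    ((wgt (r, x.1)).+1%:Z - (wgt (x.2, x.1))%:Z + pathWgt x.2 p')%R
  else 0%R.

Fixpoint usedEdges r p : seq edge :=
  if p is x :: p' then (r, x.1) :: usedEdges x.2 p' else [::].

Definition freeEdges p : seq edge := [seq (x.2, x.1) | x <- p].

Lemma pathWgtE r p : (pathWgt r p + (\sum_(q <- freeEdges p) wgt q)%:Z =
  (\sum_(q <- usedEdges r p) wgt q + size p)%:Z)%R.
Proof.
elim: p r => [|x p IH] r /=; first by rewrite !big_nil.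
rewrite !big_cons; have := IH x.2; lia.
Qed.

Lemma unzip1_usedEdges r p : unzip1 (usedEdges r p) = belast r (map snd p).
Proof. by elim: p r => [|x p IH] r //=; rewrite IH. Qed.

Lemma unzip2_usedEdges r p : unzip2 (usedEdges r p) = unzip2 (freeEdges p).
Proof. by elim: p r => [|x p IH] r //=; rewrite IH. Qed.

Lemma unzip1_freeEdges p : unzip1 (freeEdges p) = map snd p.
Proof. by rewrite /unzip1 -map_comp. Qed.

Lemma uniq_usedEdges r p : uniq (belast r (map snd p)) -> uniq (usedEdges r p).
Proof. by rewrite -unzip1_usedEdges; apply: map_uniq. Qed.

Lemma uniq_freeEdges p : uniq (map snd p) -> uniq (freeEdges p).
Proof. by rewrite -unzip1_freeEdges; apply: map_uniq. Qed.

Lemma uniq_belast (T : eqType) (x : T) (s : seq T) : uniq (x :: s) -> uniq (belast x s).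
Proof. by rewrite lastI rcons_uniq => /andP[]. Qed.

Lemma isPath_sub F F' r p : F \subset F' -> isPath F r p -> isPath F' r p.
Proof.
move=> sFF; elim: p r => //= x p IH r /and4P[xF -> -> /IH->].
by rewrite (subsetP sFF).
Qed.

Lemma isPath_used F r p : isPath F r p -> {subset usedEdges r p <= F}.
Proof.
elim: p r => //= x p IH r /and4P[xF _ _ /IH H] q.
by rewrite inE => /orP[/eqP->|/H].
Qed.

Lemma used_isPath F F' r p : isPath F r p -> {subset usedEdges r p <= F'} ->
  isPath F' r p.
Proof.
elim: p r => //= x p IH r /and4P[_ -> -> xp] H.
by rewrite H ?mem_head //= IH // => q qp; rewrite H // inE qp orbT.
Qed.

Lemma isPath_free F r p : isPath F r p -> {subset freeEdges p <= G}.
Proof.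
elim: p r => //= x p IH r /and4P[_ xG _ /IH H] q.
by rewrite inE => /orP[/eqP->|/H].
Qed.

Lemma isPath_cat F r p1 p2 :
  isPath F r (p1 ++ p2) = isPath F r p1 && isPath F (last r (map snd p1)) p2.
Proof. by elim: p1 r => //= x p IH r; rewrite IH !andbA. Qed.

Lemma pathWgt_cat r p1 p2 :
  (pathWgt r (p1 ++ p2) = pathWgt r p1 + pathWgt (last r (map snd p1)) p2)%R.
Proof. by elim: p1 r => [|x p IH] r /=; rewrite ?add0r // IH addrA. Qed.

Lemma size_rows r p : uniq (rows r p) -> size p < k.
Proof.
move=> up; have sub : {subset rows r p <= enum 'I_k} by move=> x _; rewrite mem_enum.
by have := uniq_leq_size up sub; rewrite size_enum_ord /= size_map.
Qed.

Definition goodPath F r p : bool := isPath F r p && uniq (rows r p).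

(** Longest path weights solve difference constraints minimally whenever they are solvable. Only
    simple paths enter, so the maximum exists for every [F]; they have fewer than [k] steps, whence
    the bounded sequences. The cut at 0 is harmless, as the empty path has weight 0. *)
Definition pot F r : nat :=
  \max_(p : k.-bseq ('I_n * 'I_k)%type | goodPath F r p) `|Num.max 0%R (pathWgt r p)|%N.

Lemma pot_ge F r p : goodPath F r p -> (pathWgt r p <= (pot F r)%:Z)%R.
Proof.
move=> gp; have /andP[_ /size_rows/ltnW szp] := gp.
pose q : k.-bseq _ := Bseq szp.
have : `|Num.max 0%R (pathWgt r q)|%N <= pot F r.
  by rewrite /pot; apply: (leq_bigmax_cond (F := fun q : k.-bseq _ =>
    `|Num.max 0%R (pathWgt r q)|%N)).
rewrite /=; lia.
Qed.

Lemma pot_attained F r :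
  exists2 p, goodPath F r p & ((pot F r)%:Z = pathWgt r p)%R.
Proof.
have [| p gp E] := @eq_bigmax_cond (k.-bseq ('I_n * 'I_k)%type)
  (fun q => goodPath F r q) (fun q => `|Num.max 0%R (pathWgt r q)|%N).
  by apply/card_gt0P; exists (Bseq (isT : size ([::] : seq ('I_n * 'I_k)) <= k)).
have [le0|gt0] := lerP (pathWgt r p) 0; last first.
  by exists p => //; rewrite /pot E; lia.
by exists [::] => //=; rewrite /pot E; lia.
Qed.

Lemma pot_sub F F' r : F \subset F' -> pot F r <= pot F' r.
Proof.
move=> sFF; have [p /andP[pF up] E] := pot_attained F r.
have := @pot_ge F' r p; rewrite /goodPath (isPath_sub sFF pF) up => /(_ isT); lia.
Qed.

Lemma pot_row0 F r : erow F r = set0 -> pot F r = 0.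
Proof.
move=> E; have [[|x p] /andP[/= pF _] Ep] := pot_attained F r; first by lia.
have /and4P[xF _ _ _] := pF.
by have : (r, x.1) \in erow F r; [rewrite inE xF eqxx | rewrite E inE].
Qed.

Lemma sec_path_le u F r p : F \subset sec G u -> isPath F r p ->
  (pathWgt r p + (u (last r (map snd p)))%:Z <= (u r)%:Z)%R.
Proof.
move=> sF; elim: p r => [|[l s] p IH] r; first by rewrite /=; lia.
move=> /= /and4P[lF lG sr pp].
have /secP[_ /(_ s sr lG) lt] := subsetP sF _ lF.
have := IH s pp; lia.
Qed.

(** Telescoping the constraints along a path bounds its weight by [u r] minus the nonnegative
    potential at its end. *)
Lemma pot_le u F r : F \subset sec G u -> pot F r <= u r.
Proof.
move=> sF; have [p /andP[gp _] E] := pot_attained F r.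
by have := sec_path_le sF gp; lia.
Qed.

Definition pot_bound : nat := \sum_(p : edge) wgt p + k.

Lemma pot_le_bound F r : pot F r <= pot_bound.
Proof.
have [p /andP[pF up] E] := pot_attained F r.
have := pathWgtE r p; have := size_rows up.
rewrite (big_uniq _ (uniq_usedEdges (uniq_belast up))) /=.
have le : \sum_(q in usedEdges r p) wgt q <= \sum_(q : edge) wgt q.
  by rewrite [X in _ <= X](bigID (mem (usedEdges r p))) /= leq_addr.
rewrite /pot_bound.
move: le; move: (\sum_(q in usedEdges r p) wgt q) (\sum_(q : edge) wgt q) => a b.
move: (\sum_(q <- freeEdges p) wgt q) => c; lia.
Qed.

Lemma card_line (A : {set edge}) (s : seq edge) (P : pred edge) : uniq s ->
  {subset s <= A} -> #|[set q in A | P q]| = #|[set q in A :\: [set q in s] | P q]| + count P s.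
Proof.
move=> us sA.
have -> : count P s = #|[set q in A :&: [set q in s] | P q]|.
  rewrite -size_filter -(card_uniqP (filter_uniq P us)).
  apply: eq_card => q; rewrite !inE mem_filter andbC.
  by case: (boolP (q \in s)) => [/sA->|]; rewrite ?andbF ?andbT.
rewrite addnC -cardsUI [X in _ + X](_ : _ = 0) ?addn0.
  apply: eq_card => q; rewrite !inE.
  by case: (q \in A); case: (q \in s); case: (P q).
apply: eq_card0 => q; rewrite !inE.
by case: (q \in A); case: (q \in s); case: (P q).
Qed.

(** Consequently a set with at most one edge per column, such as a matching or a sector, avoids the
    free edges of its paths. *)
Lemma isPath_free_used F r p q : isPath F r p -> q \in freeEdges p ->
  exists2 s, (s, q.2) \in F & s != q.1.
Proof.
elim: p r => //= x p IH r /and4P[xF _ xr /IH H].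
by rewrite inE => /orP[/eqP->|/H //]; exists r; rewrite // eq_sym.
Qed.

(* Rotating a matching along a closed path keeps its type. *)
Lemma cycle_wgt_le0 F (c : ENbasis k n) r p : isMat G F c ->
  (forall F', isMat G F' c -> cost F <= cost F') ->
  isPath F r p -> last r (map snd p) = r -> uniq (map snd p) ->
  (pathWgt r p <= 0)%R.
Proof.
move=> mF minF pF lastp up.
(* On a closed path the rows left and the rows entered agree as multisets, so exchanging used for
   free edges keeps row sizes; column sizes survive because each step stays in one column. *)
have perm_rows : perm_eq (belast r (map snd p)) (map snd p).
  have : perm_eq (r :: map snd p) (rcons (belast r (map snd p)) (last r (map snd p))).
    by rewrite -lastI.
  by rewrite lastp perm_sym perm_rcons perm_cons.
have uU : uniq (usedEdges r p) by apply: uniq_usedEdges; rewrite (perm_uniq perm_rows).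
have uN : uniq (freeEdges p) by apply: uniq_freeEdges.
pose Us := [set q in usedEdges r p]; pose Ns := [set q in freeEdges p].
have sUF : Us \subset F by apply/subsetP => q; rewrite inE => /(isPath_used pF).
have sNG : Ns \subset G by apply/subsetP => q; rewrite inE => /(isPath_free pF).
have notN q : q \in F -> q \notin freeEdges p.
  move=> qF; apply/negP => /(isPath_free_used pF)[s sF /eqP]; apply.
  by apply: (isMat_col1 mF sF); rewrite -surjective_pairing.
pose F' := (F :\: Us) :|: Ns.
have F'D : F' :\: Ns = F :\: Us.
  apply/setP => q; rewrite !inE; case: (boolP (q \in freeEdges p)) => //= qN.
    by case qF: (q \in F); rewrite ?andbF //; have := notN q qF; rewrite qN.
  by rewrite orbF.
have /isMatP[sFG rowF colF] := mF.
have line (P : pred edge) : count P (usedEdges r p) = count P (freeEdges p) ->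
    #|[set q in F' | P q]| = #|[set q in F | P q]|.
  move=> E; rewrite (@card_line F' _ P uN) ?(@card_line F _ P uU) ?E.
  - by rewrite -/Ns F'D.
  - exact: (isPath_used pF).
  - by move=> q qN; rewrite !inE qN orbT.
have mF' : isMat G F' c.
  apply/isMatP; split.
  - apply/subUsetP; split=> //; apply: subset_trans sFG; exact: subsetDl.
  - move=> s; rewrite -rowF; apply: line.
    rewrite -!(count_map fst (pred1 s)) -/(unzip1 _) -/(unzip1 _).
    by rewrite unzip1_usedEdges unzip1_freeEdges; apply/seq.permP.
  - move=> l; rewrite -colF; apply: line.
    by rewrite -!(count_map snd (pred1 l)) -/(unzip2 _) -/(unzip2 _) unzip2_usedEdges.
have [p0|pn0] := eqVneq p [::]; first by rewrite p0.
have neqF : F != F'.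
  have [q qN] : exists q, q \in freeEdges p.
    by case: (p) pn0 => // x p1 _; exists (x.2, x.1); rewrite mem_head.
  apply/eqP => EF; have := notN q; rewrite EF !inE qN orbT.
  by move=> /(_ isT).
(* A nontrivial rotation of an optimal matching costs at least [k.+1], more than the slack
   [size p <= k] inside [pathWgt]. *)
have gap := wgt_gap neqF (minF _ mF').
have sumS (s : seq edge) : uniq s -> \sum_(q in [set q in s]) wgt q = \sum_(q <- s) wgt q.
  by move=> us; rewrite (big_uniq _ us) /=; apply: eq_bigl => q; rewrite inE.
have E1 : \sum_(q in F) wgt q = \sum_(q in F :\: Us) wgt q + \sum_(q <- usedEdges r p) wgt q.
  rewrite -sumS // (big_setID Us) /= addnC; congr addn.
  by rewrite (setIidPr sUF).
have E2 : \sum_(q in F') wgt q = \sum_(q in F :\: Us) wgt q + \sum_(q <- freeEdges p) wgt q.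
  rewrite -sumS // (big_setID Ns) /= addnC; congr addn; first by rewrite F'D.
  by rewrite (setIidPr _) // subsetUr.
have szp : size p <= k.
  have sub : {subset map snd p <= enum 'I_k} by move=> x _; rewrite mem_enum.
  by have := uniq_leq_size up sub; rewrite size_enum_ord /= size_map.
move: szp gap (pathWgtE r p); rewrite E1 E2.
move: (\sum_(q in F :\: Us) wgt q) (\sum_(q <- usedEdges r p) wgt q)
  (\sum_(q <- freeEdges p) wgt q) => a b d; clear; lia.
Qed.

(** Longest path weights satisfy the constraints unless a closed path has positive weight, and
    rotating along such a path would contradict optimality. *)
Lemma min_cost_sec F (c : ENbasis k n) : isMat G F c ->
  (forall F', isMat G F' c -> cost F <= cost F') -> F \subset sec G (pot F).
Proof.
move=> mF minF; have /isMatP[sFG _ _] := mF.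
apply/subsetP => -[r l] rF; apply/secP; split=> [|s sr sG]; first exact: (subsetP sFG).
have [p /andP[pF up] Ep] := pot_attained F s.
have [rp|rp] := boolP (r \in rows s p); last first.
  have gp : goodPath F r ((l, s) :: p) by rewrite /goodPath /= rF sG sr pF rp; exact: up.
  by have := pot_ge gp => /=; move: Ep; clear; lia.
have [p1 [p2 Ep12 lastp1]] : exists p1, exists2 p2, p = p1 ++ p2 & last s (map snd p1) = r.
  move: rp; rewrite inE => /orP[/eqP->|]; first by exists [::], p.
  move=> /mapP[x xp rx]; have /splitPr xpp := xp; case: xpp => p1 p2.
  by exists (rcons p1 x), p2; rewrite ?cat_rcons // map_rcons last_rcons.
move: pF up Ep; rewrite Ep12 isPath_cat lastp1 pathWgt_cat lastp1.
rewrite /rows map_cat -cat_cons => /andP[pF1 pF2].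
rewrite cat_uniq => /and3P[up1 nhas up2] Ep.
(* The longest path from [s] visits [r]. Its part up to [r], closed by the step from [r] to [s], has
   weight at most 0, and the rest is a simple path from [r]. *)
have := @cycle_wgt_le0 F c r ((l, s) :: p1) mF minF.
rewrite /= rF sG sr pF1 lastp1 => /(_ isT erefl up1) cyc.
have gp2 : goodPath F r p2.
  rewrite /goodPath pF2 /= up2 andbT.
  apply: contra nhas => rp2; apply/hasP; exists r => //.
  by rewrite -lastp1; exact: mem_last.
by have := pot_ge gp2; move: Ep cyc; clear; lia.
Qed.

End Potentials.

(** * The pairing of cells *)

Section Toggling.

Variables (k n : nat) (G : {set 'I_k * 'I_n}).

Local Notation edge := ('I_k * 'I_n)%type.
Implicit Types (F : {set edge}) (r s : 'I_k) (l : 'I_n) (u : {ffun 'I_k -> nat}).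
Implicit Types (p : seq ('I_n * 'I_k)) (q : edge) (m : {ffun edge -> nat}).

Definition potf F : {ffun 'I_k -> nat} := [ffun r => pot G F r].

Lemma sec_ext (u v : 'I_k -> nat) : u =1 v -> sec G u = sec G v.
Proof.
move=> uv; apply/setP => -[r l]; apply/secP/secP => -[rG H]; split=> // s sr sG.
  by rewrite -!uv H.
by rewrite !uv H.
Qed.

Lemma sec_potf F : sec G (potf F) = sec G (pot G F).
Proof. by apply: sec_ext => r; rewrite ffunE. Qed.

Lemma potfE F u r : potf F = u -> pot G F r = u r.
Proof. by move <-; rewrite ffunE. Qed.

(** One half of the interval property: adding edges of the sector keeps the least potential, by
    monotonicity and leastness. *)
Lemma potf_squeeze F F' u : F \subset F' -> F' \subset sec G u ->
  potf F = u -> potf F' = u.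
Proof.
move=> sFF sF' E; apply/ffunP => r.
have := pot_sub G r sFF; have := pot_le r sF'.
by rewrite -E !ffunE; lia.
Qed.

(** Used edges lie in the sector, and free edges, sharing a column with a used one, lie outside.
    Equal weights make the used edges of either path plus the free edges of the other weigh the same
    up to slack; genericity identifies these two sets, and the sector separates used from free. *)
Lemma attained_unique u F1 F2 r p1 p2 : F1 \subset sec G u -> F2 \subset sec G u ->
  goodPath G F1 r p1 -> goodPath G F2 r p2 -> pathWgt r p1 = pathWgt r p2 ->
  {subset usedEdges r p1 <= usedEdges r p2}.
Proof.
move=> s1 s2 /andP[pF1 up1] /andP[pF2 up2] E.
have used_sec F p : F \subset sec G u -> isPath G F r p ->
    {subset usedEdges r p <= sec G u}.
  by move=> sF pF q /(isPath_used pF) /(subsetP sF).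
have free_sec F p : F \subset sec G u -> isPath G F r p ->
    forall q, q \in sec G u -> q \notin freeEdges p.
  move=> sF pF q qs; apply/negP => /(isPath_free_used pF)[s sqF /eqP]; apply.
  by apply: (sec_col_inj (subsetP sF _ sqF)); rewrite -surjective_pairing.
pose ut p := [set q in usedEdges r p]; pose ft p := [set q in freeEdges p].
have sumUF F F' p p' : F \subset sec G u -> F' \subset sec G u ->
    isPath G F r p -> isPath G F' r p' -> uniq (rows r p) -> uniq (rows r p') ->
    \sum_(q in ut p :|: ft p') wgt q =
    \sum_(q <- usedEdges r p) wgt q + \sum_(q <- freeEdges p') wgt q.
  move=> sF sF' pF pF' up up'.
  have uU := uniq_usedEdges (uniq_belast up).
  have uN : uniq (freeEdges p') by apply: uniq_freeEdges; case/andP: up'.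
  rewrite (eq_bigl [in [predU ut p & ft p']]); last by move=> q; rewrite !inE.
  rewrite bigU /=; last first.
    rewrite disjoints_subset; apply/subsetP => q; rewrite !inE => /(used_sec _ _ sF pF).
    exact: (free_sec _ _ sF' pF').
  rewrite (big_uniq _ uU) (big_uniq _ uN) /=.
  by congr addn; apply: eq_bigl => q; rewrite inE.
have Eset : ut p1 :|: ft p2 = ut p2 :|: ft p1.
  apply: (@wgt_generic _ _ _ _ (size p1) (size p2)).
  - exact: ltnW (size_rows up1).
  - exact: ltnW (size_rows up2).
  rewrite (sumUF F1 F2) // (sumUF F2 F1) //.
  move: (pathWgtE r p1) (pathWgtE r p2); rewrite E; clear.
  move: (\sum_(q <- usedEdges r p1) wgt q) (\sum_(q <- usedEdges r p2) wgt q) => a b.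
  move: (\sum_(q <- freeEdges p1) wgt q) (\sum_(q <- freeEdges p2) wgt q) => c d.
  lia.
move=> q qp1; have : q \in ut p1 :|: ft p2 by rewrite !inE qp1.
rewrite Eset !inE => /orP[] // qf.
by have := free_sec _ _ s1 pF1 q (used_sec _ _ s1 pF1 _ qp1); rewrite qf.
Qed.

(** The other half of the interval property: a longest path in [F1] also runs inside [F2], by
    [attained_unique]. *)
Lemma potf_setI u F1 F2 : F1 \subset sec G u -> F2 \subset sec G u ->
  potf F1 = u -> potf F2 = u -> potf (F1 :&: F2) = u.
Proof.
move=> s1 s2 E1 E2; apply/ffunP => r; apply/eqP; rewrite eqn_leq ffunE.
rewrite (pot_le (u := u)) /=; last exact: subset_trans (subsetIl _ _) s1.
have [p1 gp1 Ep1] := pot_attained G F1 r; have [p2 gp2 Ep2] := pot_attained G F2 r.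
have Ew : pathWgt r p1 = pathWgt r p2.
  by rewrite -Ep1 -Ep2 (potfE r E1) (potfE r E2).
have sub := attained_unique s1 s2 gp1 gp2 Ew.
have /andP[pF1 up1] := gp1; have /andP[pF2 up2] := gp2.
have gp : goodPath G (F1 :&: F2) r p1.
  rewrite /goodPath up1 andbT; apply: (used_isPath pF1) => q qp.
  by rewrite inE (isPath_used pF1) //= (isPath_used pF2) // sub.
by have := pot_ge gp; rewrite -Ep1 (potfE r E1); clear; lia.
Qed.

(** Every constraint along a longest path is tight, so its tails are longest too. *)
Lemma attained_tail u F s p r l : F \subset sec G u -> goodPath G F s p ->
  pathWgt s p = (u s)%:Z%R -> (r, l) \in usedEdges s p ->
  exists p', [/\ goodPath G F r p', pathWgt r p' = (u r)%:Z%R & (r, l) \in usedEdges r p'].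
Proof.
move=> sF; elim: p s => // -[j t] p IH s gp Ew rlp.
have [rs|rs] := eqVneq r s; first by subst s; exists ((j, t) :: p).
have /andP[/= /and4P[sjF tG ts pF] /andP[_ up]] := gp.
move: rlp; rewrite /= inE => /orP[/eqP[E _]|rlp]; first by rewrite E eqxx in rs.
apply: (IH t) => //; first by apply/andP.
have := sec_path_le sF pF; have /secP[_ /(_ t ts tG)] := subsetP sF _ sjF.
by move: Ew => /=; clear; lia.
Qed.

Lemma used_row_inj r p s l l' : uniq (rows r p) ->
  (s, l) \in usedEdges r p -> (s, l') \in usedEdges r p -> l = l'.
Proof.
move=> /uniq_belast; rewrite -unzip1_usedEdges.
elim: (usedEdges r p) => //= -[t j] es IH /andP[nt /IH H].
rewrite !inE => /orP[/eqP[-> ->]|sl] /orP[/eqP[]|sl'].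
- by move->.
- by case/negP: nt; apply/mapP; exists (t, l').
- by move=> ts _; case/negP: nt; apply/mapP; exists (s, l).
- exact: H.
Qed.

(** If neither edge could be deleted, each would lie on a longest path from [r]. Such paths use the
    same edges, and a simple path leaves [r] only once. *)
Lemma essential_unique u F r l l' : F \subset sec G u -> potf F = u ->
  (r, l) \in F -> (r, l') \in F -> l != l' ->
  potf (F :\ (r, l)) = u \/ potf (F :\ (r, l')) = u.
Proof.
move=> sF E lF l'F neq.
have potE s : pot G F s = u s by apply: potfE.
have ess (j : 'I_n) : potf (F :\ (r, j)) != u ->
    exists p', [/\ goodPath G F r p', pathWgt r p' = (u r)%:Z%R & (r, j) \in usedEdges r p'].
  move=> /eqP ne; have [s nes] : exists s : 'I_k, pot G (F :\ (r, j)) s != u s.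
    apply/existsP; rewrite -negb_forall; apply/negP => /forallP H; apply: ne.
    by apply/ffunP => s; rewrite ffunE; apply/eqP.
  have [p gp Ep] := pot_attained G F s.
  apply: (attained_tail sF gp); first by rewrite -Ep potE.
  apply: contraR nes => nused; rewrite eqn_leq.
  rewrite pot_le /=; last exact: subset_trans (subD1set _ _) sF.
  have /andP[pF up] := gp.
  have gp' : goodPath G (F :\ (r, j)) s p.
    rewrite /goodPath up andbT; apply: (used_isPath pF) => q qp.
    by rewrite !inE (isPath_used pF) // andbT; apply: contraNneq nused => <-.
  by have := pot_ge gp'; rewrite -Ep potE; clear; lia.
have [|/ess[p [gp Ep lp]]] := eqVneq (potf (F :\ (r, l))) u; first by left.
have [|/ess[p' [gp' Ep' lp']]] := eqVneq (potf (F :\ (r, l'))) u; first by right.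
have sub := attained_unique sF sF gp' gp (etrans Ep' (esym Ep)).
have /andP[_ up] := gp.
by case/eqP: neq; apply: used_row_inj up lp (sub _ lp').
Qed.

Definition msupp m : {set edge} := [set q | 0 < m q].

(** The second clause encodes optimality, by [sec_min_cost] and [min_cost_sec]. The basis element is
    not recorded because the row and column sizes of [F] determine it. *)
Definition cell m F : bool :=
  [&& F \subset msupp m, F \subset sec G (potf F) & [forall r, erow F r != set0]].

Lemma cellP m F : reflect [/\ F \subset msupp m, F \subset sec G (potf F)
  & forall r, erow F r != set0] (cell m F).
Proof. by apply: (iffP and3P) => -[? ? /forallP]. Qed.

Definition avail m u : {set edge} := sec G u :&: msupp m.

Lemma avail_sec m u : avail m u \subset sec G u. Proof. exact: subsetIl. Qed.

Lemma cell_avail m F : cell m F -> F \subset avail m (potf F).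
Proof. by move=> /cellP[s1 s2 _]; rewrite subsetI s1 s2. Qed.

Lemma potf_avail m F : cell m F -> potf (avail m (potf F)) = potf F.
Proof. by move=> cF; apply: (potf_squeeze (cell_avail cF) (avail_sec _ _)). Qed.

Definition opts m u : {set edge} :=
  [set q in avail m u | potf (avail m u :\ q) == u].

(** Depends only on [m] and the potential, so both members of a pair choose the same edge. *)
Definition pivot m u r : option edge := [pick q in opts m u | q.1 == r].

(** A row reduced to its pivot is inactive: removing the pivot would empty it, and adding the pivot
    to a nonempty row never produces it. *)
Definition active m F r : bool :=
  if pivot m (potf F) r is Some q then erow F r != [set q] else false.

Definition firstActive m F : option 'I_k :=
  [pick r | active m F r && [forall s : 'I_k, (s < r) ==> ~~ active m F s]].

Definition toggle m F : option edge :=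
  if firstActive m F is Some r then pivot m (potf F) r else None.

Lemma firstActiveP m F : match firstActive m F with
  | Some r => active m F r /\ forall s : 'I_k, s < r -> ~~ active m F s
  | None => forall r, ~~ active m F r end.
Proof.
rewrite /firstActive; case: pickP => [r /andP[ar /forallP H]|none].
  by split=> // s sr; move: (H s); rewrite sr.
move=> r; apply/negP => ar.
case: (arg_minnP (fun i : 'I_k => val i) ar) => i ai mini.
have := none i; rewrite ai => /negbT/negP; apply; apply/forallP => s.
by apply/implyP => lts; apply/negP => /mini; rewrite leqNgt lts.
Qed.

Lemma firstActive_uniq m F r : active m F r ->
  (forall s : 'I_k, s < r -> ~~ active m F s) -> firstActive m F = Some r.
Proof.
move=> ar H; have := firstActiveP m F; case: firstActive => [t [aT Ht]|/(_ r)].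
  case: (ltngtP (nat_of_ord t) r) => [/H|/Ht|/ord_inj->//]; first by rewrite aT.
  by rewrite ar.
by rewrite ar.
Qed.

Lemma pivotP m u r q : pivot m u r = Some q ->
  [/\ q \in avail m u, potf (avail m u :\ q) = u & q.1 = r].
Proof.
rewrite /pivot; case: pickP => // q' /andP[]; rewrite inE => /andP[qa /eqP E] /eqP qr [<-].
by split.
Qed.

Lemma toggleP m F q : toggle m F = Some q -> exists r,
  [/\ firstActive m F = Some r, pivot m (potf F) r = Some q, q.1 = r & erow F r != [set q]].
Proof.
rewrite /toggle; have := firstActiveP m F.
case: firstActive => // r [ar _] E; exists r; split=> //; first by have [] := pivotP E.
by move: ar; rewrite /active E.
Qed.

Lemma in_erow F q r : (q \in erow F r) = (q \in F) && (q.1 == r).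
Proof. by rewrite inE. Qed.

Lemma erow_setD1 F q r : erow (F :\ q) r = erow F r :\ q.
Proof. by apply/setP => x; rewrite !inE; case: (x != q); rewrite ?andbF. Qed.

Lemma erow_setU1 F q : erow (q |: F) q.1 = q |: erow F q.1.
Proof. by apply/setP => x; rewrite !inE; case: (eqVneq x q) => // ->; rewrite eqxx. Qed.

(** Removability is tested in the largest set [avail m (potf F)] and passes to [F] by
    intersection. *)
Lemma potf_pivot m F r q : cell m F -> pivot m (potf F) r = Some q ->
  potf (F :\ q) = potf F.
Proof.
move=> cF /pivotP[_ potD _]; have /cellP[_ ssec _] := cF.
have -> : F :\ q = F :&: (avail m (potf F) :\ q).
  apply/setP => x; rewrite !inE; case: (x != q) => //=; rewrite ?andbF //.
  case xF: (x \in F) => //=; have := subsetP (cell_avail cF) x xF.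
  by rewrite !inE => /andP[-> ->].
apply: potf_setI => //.
by apply: subset_trans (subD1set _ _) (avail_sec _ _).
Qed.

(** The switch preserves the potential, hence the pivots, and also the set of active rows; this
    makes the pairing an involution. *)
Lemma toggle_remove m F q : cell m F -> toggle m F = Some q -> q \in F ->
  [/\ cell m (F :\ q), potf (F :\ q) = potf F & toggle m (F :\ q) = Some q].
Proof.
move=> cF tq qF; have [r [fa pv qr neq]] := toggleP tq.
have [qa potD _] := pivotP pv; have /cellP[sm ssec ne] := cF.
have E : potf (F :\ q) = potf F by apply: potf_pivot cF pv.
have qrow : q \in erow F r by rewrite inE qF qr eqxx.
have nerow : erow F r :\ q != set0.
  by apply: contra neq; rewrite setD_eq0 subset1 => /orP[//|/eqP E0]; rewrite E0 inE in qrow.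
have cF' : cell m (F :\ q).
  apply/cellP; rewrite E; split.
  - exact: subset_trans (subD1set _ _) sm.
  - exact: subset_trans (subD1set _ _) ssec.
  move=> s; rewrite erow_setD1; have [->//|sr] := eqVneq s r.
  rewrite (_ : _ :\ q = erow F s) //; apply/setP => x; rewrite !inE.
  by case: (eqVneq x q) => // ->; rewrite qr eq_sym (negPf sr) andbF.
split; [exact: cF' | exact: E | ].
have act s : active m (F :\ q) s = active m F s.
  rewrite /active E; have [->|sr] := eqVneq s r.
    rewrite pv neq erow_setD1; apply/eqP => E1.
    by have := set11 q; rewrite -E1 !inE eqxx.
  rewrite erow_setD1 (_ : _ :\ q = erow F s) //; apply/setP => x; rewrite !inE.
  by case: (eqVneq x q) => // ->; rewrite qr eq_sym (negPf sr) andbF.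
have faE : firstActive m (F :\ q) = Some r.
  have := firstActiveP m F; rewrite fa => -[ar mina].
  by apply: firstActive_uniq => [|s /mina]; rewrite act.
by rewrite /toggle faE E.
Qed.

Lemma toggle_add m F q : cell m F -> toggle m F = Some q -> q \notin F ->
  [/\ cell m (q |: F), potf (q |: F) = potf F & toggle m (q |: F) = Some q].
Proof.
move=> cF tq qF; have [r [fa pv qr neq]] := toggleP tq.
have [qa potD _] := pivotP pv; have /cellP[sm ssec ne] := cF.
have sub : q |: F \subset avail m (potf F) by rewrite subUset sub1set qa cell_avail.
have E : potf (q |: F) = potf F.
  by apply: potf_squeeze (subsetUr _ _) _ (erefl _); apply: subset_trans sub (avail_sec _ _).
have rowE s : s != r -> erow (q |: F) s = erow F s.
  move=> sr; apply/setP => x; rewrite !inE.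
  by case: (eqVneq x q) => // ->; rewrite qr eq_sym (negPf sr) !andbF.
have rowr : erow (q |: F) r = q |: erow F r by rewrite -qr erow_setU1.
have cF' : cell m (q |: F).
  apply/cellP; rewrite E; split.
  - exact: subset_trans sub (subsetIr _ _).
  - exact: subset_trans sub (avail_sec _ _).
  move=> s; have [->|sr] := eqVneq s r; last by rewrite rowE.
  by rewrite rowr; apply/set0Pn; exists q; rewrite setU11.
split; [exact: cF' | exact: E | ].
have act s : active m (q |: F) s = active m F s.
  rewrite /active E; have [->|sr] := eqVneq s r; last by rewrite rowE.
  rewrite pv neq rowr; have /set0Pn[x xr] := ne r.
  apply/eqP => /setP/(_ x); rewrite !inE.
  have xq : x != q by apply: contraNneq qF => <-; move: xr; rewrite inE => /andP[].
  by move: xr; rewrite inE (negPf xq) => ->.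
have faE : firstActive m (q |: F) = Some r.
  have := firstActiveP m F; rewrite fa => -[ar mina].
  by apply: firstActive_uniq => [|s /mina]; rewrite act.
by rewrite /toggle faE E.
Qed.

Definition activeRank m F : nat := if firstActive m F is Some r then r else k.

(** A lexicographic order packed into one number, in base [k.+1] because [activeRank] is at most
    [k]. Larger potentials rank lower. *)
Definition cellRank m F : nat :=
  (k * pot_bound k n - \sum_r potf F r) * k.+1 + activeRank m F.

Definition cellRank_bound : nat := (k * pot_bound k n).+1 * k.+1.

Lemma sum_potf_le F : \sum_r potf F r <= k * pot_bound k n.
Proof.
rewrite -[X in X * _]card_ord -sum_nat_const; apply: leq_sum => r _.
by rewrite ffunE; apply: pot_le_bound.
Qed.

Lemma activeRank_le m F : activeRank m F <= k.
Proof. by rewrite /activeRank; case: firstActive => // r; apply: ltnW. Qed.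

Lemma cellRank_lt m F : cellRank m F < cellRank_bound.
Proof.
rewrite /cellRank /cellRank_bound; have := activeRank_le m F.
move: (k * _) (\sum_r _) => a b; nia.
Qed.

Lemma sum_ffun_lt u (v : {ffun 'I_k -> nat}) : (forall r, u r <= v r) -> u != v -> \sum_r u r < \sum_r v r.
Proof.
move=> le ne; rewrite ltn_neqAle leq_sum // andbT.
apply: contra ne => /eqP E; apply/eqP/ffunP => r; apply/eqP.
rewrite eqn_leq le leqNgt; apply/negP => lt; move: E.
have le' : \sum_(i | i != r) u i <= \sum_(i | i != r) v i by exact: leq_sum.
rewrite (bigD1 r) //= [RHS](bigD1 r) //=; move: le' lt.
by move: (\sum_(i | _) u i) (\sum_(i | _) v i) (u r) (v r); clear; lia.
Qed.

(** [F1] contains [F :\ q], whose potential is that of [F], so potentials can only grow. If they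
    stay equal, row [r] of [q] lacks its pivot in [F1] and is active there; the first active row of
    [F1] then precedes [r], being distinct from it since [F1] contains its own toggled edge but not
    [q]. *)
Lemma toggle_rank_lt m F q F1 q1 : cell m F -> toggle m F = Some q -> q \in F ->
  cell m F1 -> F :\ q \subset F1 -> q \notin F1 -> toggle m F1 = Some q1 -> q1 \in F1 ->
  cellRank m F1 < cellRank m F.
Proof.
move=> cF tF qF cF1 sub nq tF1 qF1.
have [cB EB tB] := toggle_remove cF tF qF.
have le r : potf F r <= potf F1 r by rewrite -EB !ffunE pot_sub.
have [E|ne] := eqVneq (potf F) (potf F1); last first.
  have lt := sum_ffun_lt le ne; have := sum_potf_le F1; have := activeRank_le m F1.
  by rewrite /cellRank; move: lt; move: (k * _) (\sum_r _) (\sum_r _) => a b c; clear; nia.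
have [r [fa pv qr neq]] := toggleP tF; have [r1 [fa1 pv1 _ _]] := toggleP tF1.
have ar : active m F1 r.
  rewrite /active -E pv; apply: contraNneq nq => E1.
  by have := set11 q; rewrite -E1 inE => /andP[].
have := firstActiveP m F1; rewrite fa1 => -[_ /(_ r)]; rewrite ar => r1r.
have {}r1r : r1 <= r by rewrite leqNgt; apply/negP => /r1r.
have ne1 : r1 != r.
  by apply: contraNneq nq => E1; move: pv1; rewrite -E E1 pv => -[->].
rewrite /cellRank E /activeRank fa fa1 ltn_add2l ltn_neqAle r1r andbT.
by apply: contra ne1 => /eqP/ord_inj->.
Qed.

Lemma critical_inactive m F r : toggle m F = None -> ~~ active m F r.
Proof.
rewrite /toggle; have := firstActiveP m F; case: firstActive => [t [aT _] E|H _] //.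
by move: aT; rewrite /active E.
Qed.

Lemma pivot_none m F r x y : cell m F -> pivot m (potf F) r = None ->
  x \in erow (avail m (potf F)) r -> y \in erow (avail m (potf F)) r -> x = y.
Proof.
move=> cF; rewrite /pivot; case: pickP => // none _.
case: x y => [s l] [s' l'].
rewrite !in_erow /= => /andP[xa /eqP E] /andP[ya /eqP E']; subst s s'.
have [->//|ne] := eqVneq l l'.
have := essential_unique (avail_sec m _) (potf_avail cF) xa ya ne.
by case=> /eqP Eo; [have := none (r, l)|have := none (r, l')];
  rewrite [_ \in opts _ _]in_set ?xa ?ya Eo eqxx.
Qed.

Lemma critical_row m F r : cell m F -> toggle m F = None -> #|erow F r| = 1.
Proof.
move=> cF tF; have := critical_inactive r tF; rewrite /active.
case pv: pivot => [q|]; first by rewrite negbK => /eqP->; rewrite cards1.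
move=> _; apply/eqP; rewrite eqn_leq; have /cellP[_ _ /(_ r)] := cF.
rewrite -card_gt0 => ->; rewrite andbT; apply/card_le1_eqP => x y xr yr.
have sub z : z \in erow F r -> z \in erow (avail m (potf F)) r.
  by rewrite !in_erow => /andP[/(subsetP (cell_avail cF))->].
exact: (pivot_none cF pv (sub _ yr) (sub _ xr)).
Qed.

(** Otherwise the potential of [F] could be lowered by one on the rows where its gap to [v] is
    largest, with [F] still inside the sector, against leastness. *)
Lemma critical_pot_min m F (v : {ffun 'I_k -> nat}) : cell m F -> toggle m F = None ->
  (forall r, erow (avail m v) r != set0) -> (forall r, v r <= potf F r) -> v = potf F.
Proof.
move=> cF tF nev; have /cellP[_ ssec ne] := cF; set u := potf F => le.
apply/eqP; apply: contraT => neq.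
pose g := \max_r (u r - v r).
have leg r : u r <= v r + g.
  by have := leq_bigmax (F := fun r => u r - v r) r; rewrite -/g; clear; lia.
have [|r0 r0g] := @bigop.eq_bigmax 'I_k (fun r => u r - v r).
  apply/card_gt0P.
  have [k0|k0] := posnP k; last by exists (Ordinal k0).
  by case/eqP: neq; apply/ffunP => r; have := ltn_ord r; rewrite {2}k0.
have g0 : 0 < g.
  rewrite lt0n; apply: contra neq => /eqP E0; apply/eqP/ffunP => r.
  by apply/eqP; rewrite eqn_leq le -[v r]addn0 -E0 leg.
pose W := [set r | u r - v r == g].
have Wgt0 r : r \in W -> 0 < u r by rewrite inE => /eqP; move: g0; clear; lia.
(* A pivot would be the only edge of [F] in its row. Deleting it keeps the potential, yet an empty
   row has potential 0, against [Wgt0]. *)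
have Wpivot r : r \in W -> pivot m u r = None.
  move=> rW; case pv: pivot => [q|//]; have := critical_inactive r tF.
  rewrite /active pv negbK => /eqP rowF.
  have := potfE r (potf_pivot cF pv); rewrite pot_row0 => [E|].
    by have := Wgt0 r rW; rewrite -E.
  by rewrite erow_setD1 rowF setDv.
pose u' : {ffun 'I_k -> nat} := [ffun r => u r - (r \in W)].
have u'E r : u' r = u r - (r \in W) by rewrite [u' r]ffunE.
have sF' : F \subset sec G u'.
  apply/subsetP => -[r l] rF; have /secP[rG Hr] := subsetP ssec _ rF.
  apply/secP; split=> // s sr sG; rewrite !u'E.
  have := Hr s sr sG; rewrite -/u; have [rW|rW] := boolP (r \in W); last first.
    by move: (leq_subr (s \in W) (u s)); rewrite subn0; clear; lia.
  have /set0Pn[[r' l'] rl'] := nev r.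
  have : r' = r by move: rl'; rewrite inE => /andP[_ /eqP].
  move=> E; subst r'; move: rl'; rewrite in_erow /= => /andP[rla _].
  have rls : (r, l') \in sec G v by move: rla; rewrite inE => /andP[].
  have /secP[_ Hv] := rls.
  have Eg t : t \in W -> u t = v t + g.
    by rewrite inE => /eqP; move: g0; clear; lia.
  (* Since the gap is largest at [r], an edge of row [r] available for [v] is available for [u] as
     well. Without a pivot the row has only one such edge, namely that of [F]. *)
  have rls' : (r, l') \in avail m u.
    rewrite inE; have -> : (r, l') \in msupp m by move: rla; rewrite inE => /andP[].
    rewrite andbT; apply/secP; split=> // [|t tr tG].
      by move: rls; rewrite inE => /andP[].
    by have := Hv t tr tG; have := leg t; rewrite (Eg r rW); clear; lia.
  have : (r, l') = (r, l).
    apply: (pivot_none cF (Wpivot r rW)); rewrite in_erow eqxx andbT //.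
    exact: (subsetP (cell_avail cF)).
  case=> El; subst l'; move=> _.
  have := Hv s sr sG; have := leg s; rewrite (Eg r rW).
  have [sW|sW] := boolP (s \in W); first by rewrite (Eg s sW); move: g0; clear; lia.
  have : u s - v s != g by move: sW; rewrite inE.
  by move: g0; clear; lia.
have r0W : r0 \in W by rewrite inE /g r0g.
have := pot_le r0 sF'; have := Wgt0 r0 r0W.
rewrite u'E r0W (potfE r0 (erefl u)).
by clear; lia.
Qed.

(** The pointwise minimum of the two potentials still leaves an available edge in each row, so both
    potentials equal it. The rows then agree, being the common pivot or the only available edge. *)
Lemma critical_unique m F F' : cell m F -> toggle m F = None ->
  cell m F' -> toggle m F' = None -> F = F'.
Proof.
move=> cF tF cF' tF'.
pose v : {ffun 'I_k -> nat} := [ffun r => minn (potf F r) (potf F' r)].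
have nev r : erow (avail m v) r != set0.
  have row_ne (H H' : {set edge}) : cell m H -> potf H r <= potf H' r ->
      (forall s, v s <= potf H s) -> v r = potf H r -> erow (avail m v) r != set0.
    move=> /cellP[sm ss /(_ r)/set0Pn[[s l]]].
    rewrite inE /= => /andP[rH /eqP E]; subst s => _ lev Ev.
    apply/set0Pn; exists (r, l); rewrite inE eqxx andbT inE (subsetP sm) // andbT.
    have /secP[rG Hr] := subsetP ss _ rH; apply/secP; split=> // s sr sG.
    by have := Hr s sr sG; have := lev s; rewrite Ev; clear; lia.
  case: (leqP (potf F r) (potf F' r)) => [le|/ltnW le].
    by apply: (row_ne F F') => // [s|]; rewrite ffunE ?geq_minl //; apply/minn_idPl.
  by apply: (row_ne F' F) => // [s|]; rewrite ffunE ?geq_minr //; apply/minn_idPr.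
have Ev : v = potf F by apply: critical_pot_min cF tF nev _ => r; rewrite ffunE geq_minl.
have Ev' : v = potf F' by apply: critical_pot_min cF' tF' nev _ => r; rewrite ffunE geq_minr.
have EF : potf F = potf F' by rewrite -Ev -Ev'.
have rowE r : erow F r = erow F' r.
  have := critical_inactive r tF; have := critical_inactive r tF'.
  rewrite /active -EF; case pv: pivot => [q|] => [|_ _].
    by rewrite !negbK => /eqP-> /eqP->.
  have /eqP/cards1P[x Ex] := critical_row r cF tF.
  have /eqP/cards1P[y Ey] := critical_row r cF' tF'.
  rewrite Ex Ey; congr [set _]; apply: (pivot_none cF pv).
    have : x \in erow F r by rewrite Ex set11.
    by rewrite !in_erow => /andP[/(subsetP (cell_avail cF))->].
  have : y \in erow F' r by rewrite Ey set11.
  by rewrite EF !in_erow => /andP[/(subsetP (cell_avail cF'))->].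
apply/setP => -[r l]; have /setP/(_ (r, l)) := rowE r.
by rewrite !inE eqxx !andbT.
Qed.

End Toggling.

(** * Coefficients of iterated polynomials *)

Local Open Scope ring_scope.

Lemma all_iotaS (a : pred nat) m : all a (iota 0 m.+1) = all a (iota 0 m) && a m.
Proof. by rewrite -[m.+1]addn1 iotaD all_cat /= andbT. Qed.

Section IteratedPolynomials.

Variable R : comNzRingType.
Implicit Types (e : nat -> nat) (Zv : pred nat).

Fixpoint mcoef (m : nat) : mpoly R m -> (nat -> nat) -> R :=
  match m return mpoly R m -> (nat -> nat) -> R with
  | 0 => fun p _ => p
  | m'.+1 => fun (p : {poly mpoly R m'}) e => mcoef p`_(e m') e
  end.

Fixpoint mterm (c : R) (e : nat -> nat) (m : nat) : mpoly R m :=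
  match m return mpoly R m with
  | 0 => c
  | m'.+1 => ((mterm c e m')%:P * 'X^(e m') : {poly mpoly R m'})
  end.

Lemma mcoef_agree m (p : mpoly R m) e e' :
  (forall i, (i < m)%N -> e i = e' i) -> mcoef p e = mcoef p e'.
Proof.
elim: m p => //= m IH p H; rewrite H //; apply: IH => i lt; apply: H.
exact: ltnW.
Qed.

Lemma mcoef_ext m (p q : mpoly R m) : (forall e, mcoef p e = mcoef q e) -> p = q.
Proof.
elim: m p q => [|m IH] p q H; first exact: (H (fun _ => 0%N)).
apply/polyP => i; apply: IH => e.
have := H (fun j => if j == m then i else e j); rewrite /= eqxx.
have agree (r : mpoly R m) : mcoef r (fun j => if j == m then i else e j) = mcoef r e.
  by apply: mcoef_agree => j lt; rewrite (ltn_eqF lt).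
by rewrite !agree.
Qed.

Lemma mcoef0 m e : mcoef (0 : mpoly R m) e = 0.
Proof. by elim: m => //= m IH; rewrite coef0. Qed.

Lemma mcoefD m (p q : mpoly R m) e : mcoef (p + q) e = mcoef p e + mcoef q e.
Proof. by elim: m p q => //= m IH p q; rewrite coefD IH. Qed.

Lemma mcoef1 m e : mcoef (1 : mpoly R m) e = (all (fun i => e i == 0%N) (iota 0 m))%:R.
Proof.
elim: m => // m IH; rewrite all_iotaS /= coef1.
by case: (e m == 0%N); rewrite ?andbT ?andbF ?mcoef0.
Qed.

Lemma mcoef_var m (p : mpoly R m) i e : (i < m)%N ->
  mcoef (mvar R m i * p) e =
  if (0 < e i)%N then mcoef p (fun j => (e j - (j == i))%N) else 0.
Proof.
elim: m p => //= m IH p; rewrite ltnS leq_eqVlt; case: eqVneq => [->|ne] /= lt.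
  rewrite coefXM; case: (posnP (e m)) => [_|pos] /=; first by rewrite mcoef0.
  rewrite subn1.
  by apply: mcoef_agree => j ltj; rewrite (ltn_eqF ltj) subn0.
by rewrite coefCM IH // subn0.
Qed.

Lemma mcoef_term m c e e' :
  mcoef (mterm c e m) e' = if all (fun i => e i == e' i) (iota 0 m) then c else 0.
Proof.
elim: m => // m IH; rewrite all_iotaS /= coefCM coefXn.
rewrite [e' m == e m]eq_sym; case: (e m == e' m); rewrite ?andbT ?andbF.
  by rewrite mulr1 IH.
by rewrite mulr0 mcoef0.
Qed.

(** Only monomials occurring in [p] have to be treated, so support conditions on [p] pass to its
    terms. *)
Lemma mpoly_ind m (p : mpoly R m) (P : mpoly R m -> Prop) : P 0 ->
  (forall a b, P a -> P b -> P (a + b)) ->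
  (forall e, mcoef p e != 0 -> P (mterm (mcoef p e) e m)) -> P p.
Proof.
move=> P0 PD.
suff gen (q : mpoly R m) : (forall e, mcoef q e != 0 -> P (mterm (mcoef q e) e m)) -> P q.
  exact: gen.
elim: m {p} P P0 PD q => [|m IH] P P0 PD q H.
  by have [->//|q0] := eqVneq q 0; apply: (H (fun _ => 0%N)).
rewrite -[q]coefK poly_def; apply: (big_ind P) => // i _.
rewrite -mul_polyC.
apply: (IH (fun a => P (a%:P * 'X^i))) => [|a b Pa Pb|e ce]; first by rewrite mul0r.
  by rewrite polyCD mulrDl; apply: PD.
have := H (fun j => if j == m then val i else e j); rewrite /= eqxx.
have agree (r : mpoly R m) : mcoef r (fun j => if j == m then val i else e j) = mcoef r e.
  by apply: mcoef_agree => j lt; rewrite (ltn_eqF lt).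
rewrite agree => /(_ ce).
suff -> : mterm (mcoef q`_i e) (fun j => if j == m then val i else e j) m =
          mterm (mcoef q`_i e) e m by [].
by apply: mcoef_ext => e'; rewrite !mcoef_term; congr (if _ then _ else _);
  apply: eq_in_all => j; rewrite mem_iota add0n => lt; rewrite (ltn_eqF lt).
Qed.

Lemma zeroVars0 m Zv : zeroVars R m Zv 0 = 0.
Proof. by elim: m => //= m IH; rewrite map_poly0 coef0 if_same. Qed.

Lemma mcoef_zeroVars m Zv (p : mpoly R m) e : mcoef (zeroVars R m Zv p) e =
  if all (fun i => Zv i ==> (e i == 0%N)) (iota 0 m) then mcoef p e else 0.
Proof.
elim: m p => // m IH p; rewrite all_iotaS /=.
case: (Zv m) => /=; last by rewrite andbT coef_map_id0 ?IH // zeroVars0.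
rewrite coefC; case: eqP => [->|_]; last by rewrite andbF mcoef0.
by rewrite andbT coef_map_id0 ?IH // zeroVars0.
Qed.

Lemma zeroVarsD m Zv (p q : mpoly R m) :
  zeroVars R m Zv (p + q) = zeroVars R m Zv p + zeroVars R m Zv q.
Proof.
apply: mcoef_ext => e; rewrite mcoefD !mcoef_zeroVars mcoefD.
by case: ifP => //; rewrite addr0.
Qed.

Lemma zeroVarsN m Zv (p : mpoly R m) : zeroVars R m Zv (- p) = - zeroVars R m Zv p.
Proof.
by apply: (addrI (zeroVars R m Zv p)); rewrite -zeroVarsD !subrr zeroVars0.
Qed.

Lemma zeroVars1 m Zv : zeroVars R m Zv 1 = 1.
Proof.
apply: mcoef_ext => e; rewrite mcoef_zeroVars !mcoef1.
case: ifP => // /negbT/allPn[i im]; rewrite negb_imply => /andP[_ ei].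
by rewrite [all _ _](negbTE _) //; apply/allPn; exists i.
Qed.

Lemma zeroVarsM m Zv (p q : mpoly R m) :
  zeroVars R m Zv (p * q) = zeroVars R m Zv p * zeroVars R m Zv q.
Proof.
elim: m p q => //= m IH p q; have z0 := zeroVars0 m Zv.
case: (Zv m); first by rewrite -polyCM !coef_map_id0 // coef0M IH.
apply/polyP => i; rewrite coef_map_id0 // !coefM.
rewrite (big_morph (zeroVars R m Zv) (@zeroVarsD m Zv) z0).
by apply: eq_bigr => j _; rewrite IH !coef_map_id0.
Qed.

End IteratedPolynomials.

Section ZeroMorphism.

Variables (R : comNzRingType) (m : nat) (Zv : pred nat).

HB.instance Definition _ := GRing.isZmodMorphism.Build (mpoly R m) (mpoly R m)
  (zeroVars R m Zv)
  (fun p q => etrans (zeroVarsD Zv p (- q)) (congr1 _ (zeroVarsN Zv q))).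

HB.instance Definition _ := GRing.isMonoidMorphism.Build (mpoly R m) (mpoly R m)
  (zeroVars R m Zv) (conj (zeroVars1 R m Zv) (@zeroVarsM R m Zv)).

End ZeroMorphism.

(** * Coefficients indexed by exponents on edges *)

Section Coefficients.

Variables (R : comNzRingType) (k n : nat).

Local Notation edge := ('I_k * 'I_n)%type.
Local Notation A := (S R k n).
Implicit Types (f g : {ffun edge -> nat}) (q : edge) (F : {set edge}) (p : A).

Definition toexp f (i : nat) : nat := (\sum_q f q * (eidx q == i))%N.

Lemma toexpE f q : toexp f (eidx q) = f q.
Proof.
rewrite /toexp (bigD1 q) //= eqxx muln1 big1 ?addn0 // => q' ne.
by rewrite (inj_eq (@eidx_inj k n)) (negPf ne) muln0.
Qed.

Definition pcoef p f : R := mcoef (m := k * n) p (toexp f).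

Definition pterm (c : R) f : A := mterm c (toexp f) (k * n).

Definition fplus f F : {ffun edge -> nat} := [ffun q => f q + (q \in F)]%N.
Definition fminus f F : {ffun edge -> nat} := [ffun q => f q - (q \in F)]%N.

Definition evar q : A := genX R k n q.1 q.2.

Lemma all_iota_eidx (a : pred nat) :
  all a (iota 0 (k * n)) = [forall q : edge, a (eidx q)].
Proof.
apply/allP/forallP => [H q|H i]; first by apply: H; rewrite mem_iota eidx_lt.
by rewrite mem_iota add0n => /eidx_surj[q <-].
Qed.

Lemma pcoef_mcoef p (e : nat -> nat) : mcoef (m := k * n) p e = pcoef p [ffun q => e (eidx q)].
Proof.
by apply: mcoef_agree => i /eidx_surj[q <-]; rewrite toexpE ffunE.
Qed.

Lemma pcoef_ext p p' : (forall f, pcoef p f = pcoef p' f) -> p = p'.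
Proof. by move=> H; apply: mcoef_ext => e; rewrite !pcoef_mcoef H. Qed.

Lemma pcoef0 f : pcoef 0 f = 0. Proof. exact: mcoef0. Qed.

Lemma pcoefD p p' f : pcoef (p + p') f = pcoef p f + pcoef p' f.
Proof. exact: mcoefD. Qed.

Lemma pcoefN p f : pcoef (- p) f = - pcoef p f.
Proof. by apply: (addrI (pcoef p f)); rewrite -pcoefD !subrr pcoef0. Qed.

Lemma pcoef_sum (I : Type) (s : seq I) (P : pred I) (E : I -> A) f :
  pcoef (\sum_(i <- s | P i) E i) f = \sum_(i <- s | P i) pcoef (E i) f.
Proof.
exact: (big_morph (pcoef^~ f) (fun p p' => pcoefD p p' f) (pcoef0 f)).
Qed.

Lemma pcoef_sign (a : nat) p f : pcoef ((-1) ^+ a * p) f = (-1) ^+ a * pcoef p f.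
Proof.
rewrite -signr_odd -[in RHS]signr_odd.
by case: (odd a); rewrite ?expr1 ?expr0 ?mulN1r ?mul1r ?pcoefN.
Qed.

Lemma pcoef1 f : pcoef 1 f = (msupp f == set0)%:R.
Proof.
rewrite /pcoef mcoef1 all_iota_eidx; congr (_%:R); apply: congr1.
apply/forallP/eqP => [H|E q].
  apply/setP => q; rewrite !inE; have := H q; rewrite toexpE => /eqP->.
  by rewrite ltnn.
by rewrite toexpE; move/setP/(_ q): E; rewrite !inE lt0n => /negbFE.
Qed.

Lemma pcoef_var q p f :
  pcoef (evar q * p) f = if (0 < f q)%N then pcoef p (fminus f [set q]) else 0.
Proof.
rewrite /pcoef /evar mxE mcoef_var; last by have := eidx_lt q.
rewrite -/(eidx q) toexpE; case: ifP => // _.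
apply: mcoef_agree => i /eidx_surj[q' <-]; rewrite !toexpE ffunE inE.
by rewrite (inj_eq (@eidx_inj k n)).
Qed.

Lemma pcoef_mon F p f : pcoef ((\prod_(q in F) evar q) * p) f =
  if F \subset msupp f then pcoef p (fminus f F) else 0.
Proof.
have gen (s : seq edge) f' : uniq s -> pcoef ((\prod_(q <- s) evar q) * p) f' =
    if [set q in s] \subset msupp f' then pcoef p (fminus f' [set q in s]) else 0.
  elim: s f' => [|q s IH] f' /=.
    rewrite big_nil mul1r (_ : [set q in [::]] = set0) ?sub0set; last first.
      by apply/setP => q; rewrite !inE.
    by move=> _; congr pcoef; apply/ffunP => q; rewrite ffunE inE subn0.
  move=> /andP[nq us]; rewrite big_cons -mulrA pcoef_var set_cons subUset sub1set.
  rewrite [q \in msupp f']inE; case: ifP => // fq; rewrite IH //=.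
  have -> : ([set q in s] \subset msupp (fminus f' [set q])) = ([set q in s] \subset msupp f').
    apply/subsetP/subsetP => H x xs; have := H x xs; rewrite !inE !ffunE !inE;
    by have -> : (x == q) = false by [apply: contraNF nq => /eqP<-; move: xs; rewrite inE];
       rewrite subn0.
  case: ifP => // _; congr pcoef; apply/ffunP => x; rewrite !ffunE !inE.
  by case: (eqVneq x q) => [->|_] /=; rewrite ?(negPf nq) subn0.
have := gen (enum F) f (enum_uniq F); rewrite big_enum /= => ->.
by rewrite (_ : [set q in enum F] = F) //; apply/setP => q; rewrite inE mem_enum.
Qed.

Lemma pcoef_term c f g : pcoef (pterm c f) g = if f == g then c else 0.
Proof.
rewrite /pcoef mcoef_term all_iota_eidx; congr (if _ then _ else _).
apply/forallP/eqP => [H|-> q //]; apply/ffunP => q; have := H q.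
by rewrite !toexpE => /eqP.
Qed.

Lemma var_pterm q c f : evar q * pterm c f = pterm c (fplus f [set q]).
Proof.
apply: pcoef_ext => g; rewrite pcoef_var !pcoef_term.
case: (posnP (g q)) => [g0|gpos].
  rewrite (_ : (fplus f [set q] == g) = false) //; apply/eqP => /ffunP/(_ q).
  by rewrite ffunE set11 g0 addn1.
congr (if _ then _ else _); apply/eqP/eqP => [->|<-]; apply/ffunP => x; rewrite !ffunE !inE.
  by case: (eqVneq x q) => [->|]; rewrite ?subn1 ?addn1 ?prednK ?subn0 ?addn0.
by rewrite addnK.
Qed.

Lemma sign_pterm (a : nat) c f : (-1) ^+ a * pterm c f = pterm ((-1) ^+ a * c) f.
Proof.
apply: pcoef_ext => g; rewrite pcoef_sign !pcoef_term.
by case: ifP; rewrite ?mulr0.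
Qed.

Lemma pterm_ind p (P : A -> Prop) : P 0 -> (forall a b, P a -> P b -> P (a + b)) ->
  (forall f, pcoef p f != 0 -> P (pterm (pcoef p f) f)) -> P p.
Proof.
move=> P0 PD H; apply: (@mpoly_ind R (k * n) p P P0 PD) => e; rewrite pcoef_mcoef => ne.
rewrite (_ : mterm _ _ _ = pterm (pcoef p [ffun q => e (eidx q)]) [ffun q => e (eidx q)]).
  exact: H.
apply: mcoef_ext => e'; rewrite /pterm !mcoef_term !all_iota_eidx.
by congr (if _ then _ else _); apply: eq_forallb => q; rewrite toexpE ffunE.
Qed.

Variable Z : {set edge}.

Lemma Zidx_eidx q : Zidx k n Z (eidx q) = (q \in Z).
Proof.
apply/existsP/idP => [[q' /andP[qZ /eqP]]|qZ]; first by move=> /eidx_inj <-.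
by exists q; rewrite qZ /= eqxx.
Qed.

Lemma pcoef_zeroZ p f :
  pcoef (zeroZ R k n Z p) f = if msupp f \subset ~: Z then pcoef p f else 0.
Proof.
rewrite /pcoef /zeroZ mcoef_zeroVars all_iota_eidx; congr (if _ then _ else _).
apply/forallP/subsetP => [H q|H q].
  rewrite !inE => fq; apply/negP => qZ; have := H q.
  by rewrite Zidx_eidx qZ toexpE /= => /eqP E; rewrite E in fq.
rewrite Zidx_eidx toexpE; apply/implyP => qZ; rewrite -leqn0 leqNgt; apply/negP => fq.
by have := H q; rewrite !inE fq qZ => /(_ isT).
Qed.

Lemma inTP p : reflect (forall f, ~~ (msupp f \subset ~: Z) -> pcoef p f = 0) (inT R k n Z p).
Proof.
apply: (iffP eqP) => [<- f|H]; first by rewrite pcoef_zeroZ => /negbTE->.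
by apply: pcoef_ext => f; rewrite pcoef_zeroZ; case: ifP => // /negbT/H->.
Qed.

HB.instance Definition _ := GRing.RMorphism.copy (zeroZ R k n Z)
  (zeroVars R (k * n) (Zidx k n Z)).

Lemma zeroZ_var q : zeroZ R k n Z (evar q) = if q \in Z then 0 else evar q.
Proof.
apply: pcoef_ext => f; rewrite pcoef_zeroZ -[evar q]mulr1.
have [qZ|qZ] := boolP (q \in Z).
  rewrite pcoef0 pcoef_var; case: ifP => // /subsetP H; case: ifP => // fq.
  by have := H q; rewrite !inE fq qZ => /(_ isT).
case: ifP => // /negbT nf; rewrite pcoef_var; case: ifP => // fq.
rewrite pcoef1; case: eqP => // /setP E; case/negP: nf; apply/subsetP => x.
rewrite !inE => fx; have := E x; rewrite !inE !ffunE !inE.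
by case: (eqVneq x q) => [-> //|_]; rewrite subn0 fx.
Qed.

Lemma inT0 : inT R k n Z 0. Proof. by rewrite /inT raddf0. Qed.

Lemma inTD p p' : inT R k n Z p -> inT R k n Z p' -> inT R k n Z (p + p').
Proof. by rewrite /inT => /eqP E /eqP E'; rewrite raddfD /= E E'. Qed.

Lemma inT_pterm c f : msupp f \subset ~: Z -> inT R k n Z (pterm c f).
Proof.
move=> sf; apply/inTP => g ng; rewrite pcoef_term; case: eqP => // E.
by rewrite -E sf in ng.
Qed.

End Coefficients.

(** * Maximal minors *)

Section MaximalMinors.

Variables (n : nat).

Definition lpos (L : {set 'I_n}) (l : 'I_n) : nat := #|[set l' in L | (l' < l)%N]|.

Definition cenum (d : nat) (L : {set 'I_n}) (cardL : #|L| = d) (b : 'I_d) : 'I_n :=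
  enum_val (cast_ord (esym cardL) b).

Lemma cenum_nth d (L : {set 'I_n}) (cardL : #|L| = d) (b : 'I_d) x :
  cenum cardL b = nth x (enum L) b.
Proof. by rewrite /cenum (enum_val_nth x). Qed.

Lemma cenum_inj d (L : {set 'I_n}) (cardL : #|L| = d) : injective (cenum cardL).
Proof. by move=> b b' /enum_val_inj/cast_ord_inj. Qed.

Lemma cenum_in d (L : {set 'I_n}) (cardL : #|L| = d) b : cenum cardL b \in L.
Proof. exact: enum_valP. Qed.

Lemma cenum_surj d (L : {set 'I_n}) (cardL : #|L| = d) l :
  l \in L -> exists b, cenum cardL b = l.
Proof.
move=> lL; exists (cast_ord cardL (enum_rank_in lL l)).
by rewrite /cenum cast_ord_comp cast_ord_id enum_rankK_in.
Qed.

Lemma cenum_mono d (L : {set 'I_n}) (cardL : #|L| = d) b b' :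
  (cenum cardL b < cenum cardL b')%N = (b < b')%N.
Proof.
have lt (i j : 'I_d) : (i < j)%N -> (cenum cardL i < cenum cardL j)%N.
  move=> ij; have sz : size (map val (enum L)) = d by rewrite size_map -cardE.
  have srt : sorted ltn (map val (enum L)).
    rewrite {1}/enum_mem -enumT.
    apply: (subseq_sorted ltn_trans (s2 := map val (enum 'I_n))).
      by apply: map_subseq; apply: filter_subseq.
    by rewrite val_enum_ord iota_ltn_sorted.
  have := sorted_ltn_nth ltn_trans 0%N srt; move=> /(_ i j).
  rewrite !inE sz !ltn_ord => /(_ isT isT ij).
  by rewrite !(nth_map (cenum cardL i)) -?cardE ?cardL // -!cenum_nth.
apply/idP/idP; last exact: lt.
apply: contraLR; rewrite -!leqNgt leq_eqVlt => /orP[/eqP/ord_inj->//|/lt/ltnW //].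
Qed.

Lemma lpos_cenum d (L : {set 'I_n}) (cardL : #|L| = d) (j : 'I_d) :
  lpos L (cenum cardL j) = j.
Proof.
rewrite /lpos (_ : [set _ in L | _] = cenum cardL @: [set i : 'I_d | (i < j)%N]).
  rewrite (card_imset _ (@cenum_inj _ _ cardL)) -sum1dep_card.
  rewrite (big_ord_narrow (ltnW (ltn_ord j))) /=.
  by rewrite sum1_card card_ord.
apply/setP => l; rewrite inE; apply/andP/imsetP => [[lL lt]|[i ij ->]].
  have [i E] := cenum_surj cardL lL; exists i => //.
  by rewrite inE -(cenum_mono cardL) E.
by rewrite cenum_in cenum_mono; rewrite inE in ij.
Qed.

Lemma lpos_setD1 (L : {set 'I_n}) x l : x \in L ->
  lpos L l = (lpos (L :\ x) l + (x < l)%N)%N.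
Proof.
move=> xL; rewrite /lpos; set B := [set l' in L | _].
have -> : [set l' in L :\ x | (l' < l)%N] = B :\ x.
  by apply/setP => y; rewrite !inE andbA.
by rewrite (cardsD1 x B) addnC inE xL.
Qed.

Lemma cenum_setD1 d (L : {set 'I_n}) (cardL : #|L| = d.+1) (j : 'I_d.+1)
  (cardL' : #|L :\ cenum cardL j| = d) (b : 'I_d) :
  cenum cardL' b = cenum cardL (lift j b).
Proof.
have lL : cenum cardL (lift j b) \in L :\ cenum cardL j.
  by rewrite !inE cenum_in andbT (inj_eq (@cenum_inj _ _ cardL)) eq_sym neq_lift.
have [b' E] := cenum_surj cardL' lL; rewrite -E; congr cenum; apply: ord_inj.
have := lpos_setD1 (cenum cardL (lift j b)) (cenum_in cardL j).
rewrite cenum_mono lpos_cenum -E lpos_cenum /= /bump; clear.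
by case: (leqP j b) => H; case: (ltnP j) => /=; lia.
Qed.

Lemma maxMinorE (A : comNzRingType) k (M : 'M[A]_(k, n)) (J : {set 'I_n}) (cardJ : #|J| = k) :
  maxMinor A k n M J = \det (\matrix_(a, b) M a (cenum cardJ b)).
Proof.
rewrite /maxMinor; congr (\det _); apply/matrixP => a b; rewrite !mxE.
by rewrite (nth_map (cenum cardJ b)) -?cardE ?cardJ // -cenum_nth.
Qed.

(* Expand, along its first row, the determinant with the row r repeated. *)
Lemma minor_laplace (A : comNzRingType) k (M : 'M[A]_(k, n)) (L : {set 'I_n}) r :
  #|L| = k.+1 ->
  \sum_(l in L) (-1) ^+ lpos L l * M r l * maxMinor A k n M (L :\ l) = 0.
Proof.
move=> cardL; pose e := cenum cardL.
pose N := \matrix_(i < k.+1, j < k.+1) if unlift ord0 i is Some a then M a (e j) else M r (e j).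
have : \det N = 0.
  apply: (@determinant_alternate _ _ N ord0 (lift ord0 r)); first exact: neq_lift.
  by move=> j; rewrite !mxE unlift_none liftK.
rewrite (expand_det_row N ord0) => E; rewrite -[RHS]E {E}.
rewrite big_enum_val (reindex (cast_ord (esym cardL))) /=; last first.
  by apply: onW_bij; exists (cast_ord cardL) => i; rewrite ?cast_ordK ?cast_ordKV.
apply: eq_bigr => j _; rewrite -/(cenum cardL j) lpos_cenum.
have cardL' : #|L :\ cenum cardL j| = k.
  by have := cardL; rewrite (cardsD1 (cenum cardL j)) cenum_in => -[].
rewrite /cofactor add0n mulrA !mxE unlift_none -/e [M r (e j) * _]mulrC; congr (_ * _).
rewrite (maxMinorE _ cardL'); congr (\det _); apply/matrixP => a b.
by rewrite !mxE liftK cenum_setD1.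
Qed.

End MaximalMinors.

(** * Minors as signed sums over matchings *)

Section MinorCoefficients.

Variables (R : comNzRingType) (k n : nat) (Z : {set 'I_k * 'I_n}).

Local Notation edge := ('I_k * 'I_n)%type.
Local Notation A := (S R k n).

Lemma isMat_transversal (J : {set 'I_n}) (cardJ : #|J| = k) (F : {set edge}) (c : ENbasis k n) :
  (forall r, c.1 r = 0%N :> nat) -> c.2 = J -> isMat (~: Z) F c ->
  exists s : 'S_k, F = [set (a, cenum cardJ (s a)) | a : 'I_k].
Proof.
move=> c1 c2 mF; have /isMatP[sF rowF colF] := mF.
pose e := cenum cardJ.
have ex a : exists b, (a, e b) \in F.
  have /card_gt0P[[a' l]] : (0 < #|erow F a|)%N by rewrite rowF.
  rewrite in_erow /= => /andP[alF /eqP E]; subst a'.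
  have : l \in J.
    rewrite -c2; apply: contraT => nl; have := colF l; rewrite (negPf nl) => /eqP.
    by rewrite cards_eq0 => /eqP/setP/(_ (a, l)); rewrite !inE alF eqxx.
  by move=> /(cenum_surj cardJ)[b E]; exists b; rewrite /e E.
pose g a := odflt a [pick b | (a, e b) \in F].
have gP a : (a, e (g a)) \in F.
  rewrite /g; case: pickP => [b //|none]; have [b] := ex a.
  by have := none b => /= ->.
have g_inj : injective g.
  by move=> a a' E; apply: (isMat_col1 mF (gP a)); rewrite E gP.
exists (perm g_inj); apply/esym/eqP; rewrite eqEsubset; apply/andP; split.
  by apply/subsetP => _ /imsetP[a _ ->]; rewrite permE gP.
apply/subsetP => -[a l] alF; apply/imsetP; exists a => //; rewrite permE.
have : (#|erow F a| <= 1)%N by rewrite rowF c1.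
move=> /card_le1_eqP/(_ (a, l) (a, e (g a))); rewrite !in_erow alF gP !eqxx.
by move=> /(_ isT isT) <-.
Qed.

Lemma transversal_isMat (J : {set 'I_n}) (cardJ : #|J| = k) (c : ENbasis k n) (s : 'S_k) :
  (forall r, c.1 r = 0%N :> nat) -> c.2 = J ->
  isMat (~: Z) [set (a, cenum cardJ (s a)) | a : 'I_k] c =
  ([set (a, cenum cardJ (s a)) | a : 'I_k] \subset ~: Z).
Proof.
move=> c1 c2; set F := [set _ | a : 'I_k].
apply/isMatP/idP => [[]//|sF]; split=> // [r|l].
  rewrite c1; apply/eqP/cards1P; exists (r, cenum cardJ (s r)).
  apply/setP => -[a l]; rewrite in_erow inE /=; apply/andP/eqP => [[/imsetP[b _ [-> ->]] /eqP->]|[-> ->]] //.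
  by split=> //; apply/imsetP; exists r.
have [lJ|lJ] := boolP (l \in c.2).
  rewrite c2 in lJ; have [b E] := cenum_surj cardJ lJ.
  apply/eqP/cards1P; exists ((s^-1)%g b, l); apply/setP => -[a l'].
  rewrite 2!inE /=; apply/andP/eqP => [[/imsetP[b' _ [-> ->]] /eqP E']|[-> ->]].
    by congr pair => //; move: E'; rewrite -E => /cenum_inj <-; rewrite permK.
  by split=> //; apply/imsetP; exists ((s^-1)%g b) => //; rewrite permKV E.
apply/eqP; rewrite cards_eq0; apply/eqP/setP => -[a l']; rewrite in_set0 inE /=.
apply/negP => /andP[/imsetP[b _ [_ ->]] /eqP E]; case/negP: lJ.
by rewrite -E c2 cenum_in.
Qed.

(** Leibniz expansion: the permutations whose graph avoids [Z] are the matchings of [c]. The sign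
    stays existential because only its being a unit matters. *)
Lemma pcoef_minor (c : ENbasis k n) : (forall r, c.1 r = 0%N :> nat) -> #|c.2| = k ->
  exists sg : {set edge} -> nat, forall (p : A) f,
    pcoef (zeroZ R k n Z (maxMinor A k n (genX R k n) c.2) * p) f =
    \sum_(F | isMat (~: Z) F c && (F \subset msupp f)) (-1) ^+ sg F * pcoef p (fminus f F).
Proof.
move=> c1 cardJ; pose tr (s : 'S_k) := [set (a, cenum cardJ (s a)) | a : 'I_k].
have tr_inj : injective tr.
  move=> s t E; apply/permP => a; apply: (@cenum_inj _ _ _ cardJ).
  have : (a, cenum cardJ (s a)) \in tr t by rewrite -E; apply/imsetP; exists a.
  by case/imsetP => b _ [-> ->].
(* The parity of the permutation with graph [F]; the default 0 concerns sets that are no such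
   graph. *)
exists (fun F => if [pick s | tr s == F] is Some s then odd_perm s : nat else 0%N) => p f.
have sgE s : (if [pick t | tr t == tr s] is Some t then odd_perm t : nat else 0%N) = odd_perm s.
  by case: pickP => [t /eqP/tr_inj->//|/(_ s)]; rewrite eqxx.
rewrite (maxMinorE _ cardJ) /determinant rmorph_sum mulr_suml pcoef_sum.
rewrite (bigID (mem (tr @: setT))) /= [X in _ = _ + X]big1 ?addr0; last first.
  move=> F /andP[/andP[mF _]] /imsetP[]; have [s ->] := isMat_transversal cardJ c1 erefl mF.
  by exists s.
rewrite (eq_bigl (fun F => (F \in tr @: setT) && (isMat (~: Z) F c && (F \subset msupp f)))); last first.
  by move=> F; rewrite andbC.
rewrite big_imset_cond /=; last by move=> s t _ _ /tr_inj.
rewrite [RHS]big_mkcond /=; apply: eq_bigr => s _.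
rewrite rmorphMsign -mulrA pcoef_sign inE sgE /=.
rewrite transversal_isMat // -/(tr s).
have -> : zeroZ R k n Z (\prod_i (\matrix_(a, b) genX R k n a (cenum cardJ b)) i (s i)) =
    if tr s \subset ~: Z then \prod_(q in tr s) evar R q else 0.
  rewrite rmorph_prod.
  rewrite (eq_bigr (fun a => zeroZ R k n Z (evar R (a, cenum cardJ (s a))))); last first.
    by move=> a _; rewrite /evar !mxE.
  case: ifP => [/subsetP H|/negbT/subsetPn[q /imsetP[a _ ->]]].
    rewrite big_imset /=; last by move=> a b _ _ [].
    apply: eq_big => // a _; rewrite zeroZ_var.
    by have := H (a, cenum cardJ (s a)); rewrite imset_f // inE => /(_ isT)/negbTE->.
  by rewrite inE negbK => qZ; rewrite (bigD1 a) //= zeroZ_var qZ mul0r.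
case: ifP => _ /=; last by rewrite mul0r pcoef0 mulr0.
by rewrite pcoef_mon; case: ifP; rewrite ?mulr0.
Qed.

End MinorCoefficients.

(** * Surviving basis elements *)

Section BasisElements.

Variables (k n : nat).

Local Notation edge := ('I_k * 'I_n)%type.
Implicit Types (c b : ENbasis k n) (q : edge) (F G : {set edge}).

(** One edge encodes both choices made by a term of the differential: the exponent lowered and the
    column deleted. *)
Definition edel c q : ENbasis k n :=
  ([ffun j => inord (c.1 j - (j == q.1))], c.2 :\ q.2).

Definition eadd c q : ENbasis k n :=
  ([ffun j => inord (c.1 j + (j == q.1))], q.2 |: c.2).

Definition edelOk c q : bool := (0 < c.1 q.1)%N && (q.2 \in c.2).

Lemma edel1 c q j : (edel c q).1 j = (c.1 j - (j == q.1))%N :> nat.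
Proof. by rewrite ffunE inordK // ltnS (leq_trans (leq_subr _ _)) // -ltnS. Qed.

Lemma edelP c q b : (b == edel c q) =
  [forall j, val (b.1 j) == (val (c.1 j) - (j == q.1))%N] && (b.2 == c.2 :\ q.2).
Proof.
apply/eqP/andP => [->|[/forallP H /eqP E]].
  by split=> //; apply/forallP => j; rewrite -[val _]/(nat_of_ord _) edel1.
rewrite [b]surjective_pairing E; congr pair; apply/ffunP => j.
by apply: ord_inj; rewrite -[RHS]/(nat_of_ord ((edel c q).1 j)) edel1; apply/eqP/H.
Qed.

Lemma edel_inj c q q' : edelOk c q -> edelOk c q' -> edel c q = edel c q' -> q = q'.
Proof.
case: q q' => [r l] [s j] /andP[/= cr lc] /andP[/= cs jc] E.
have rs : r = s.
  have := edel1 c (r, l) r; rewrite E edel1 /= eqxx.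
  by case: (eqVneq r s) => // _; move: cr; clear; lia.
have : l \notin c.2 :\ j by have /(congr1 snd) /= <- := E; rewrite !inE eqxx.
by rewrite !inE lc andbT negbK => /eqP->; rewrite rs.
Qed.

Lemma sum_edel c q : (0 < c.1 q.1)%N ->
  (\sum_r c.1 r = (\sum_r (edel c q).1 r).+1)%N.
Proof.
move=> pos; rewrite (bigD1 q.1) //= [in RHS](bigD1 q.1) //= edel1 eqxx.
rewrite [in RHS](eq_bigr (fun r => nat_of_ord (c.1 r))).
  by rewrite /= subn1 -addSn prednK.
by move=> r /negbTE ne; rewrite edel1 ne subn0.
Qed.

Lemma inENbasis_edel i c q : edelOk c q ->
  inENbasis k n i.+2 c = inENbasis k n i.+1 (edel c q).
Proof.
move=> /andP[pos lc]; rewrite /inENbasis (sum_edel pos) eqSS; congr andb.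
by rewrite (cardsD1 q.2 c.2) lc add1n addnS eqSS.
Qed.

Lemma isMat_card G F c : isMat G F c -> (#|F| = k + \sum_r c.1 r)%N /\ #|F| = #|c.2|.
Proof.
move=> /isMatP[_ rowF colF]; split.
  have := sum_edge_row F (fun _ => 1%N); rewrite sum1_card => ->.
  rewrite (eq_bigr (fun r => 1 + c.1 r)%N); last by move=> r _; rewrite muln1 rowF.
  by rewrite big_split /= sum1_card card_ord.
have := sum_edge F (fun _ => 1%N); rewrite sum1_card => ->.
rewrite -sum1_card [RHS]big_mkcond /=; apply: eq_bigr => l _.
by rewrite sum1_card colF; case: (l \in c.2).
Qed.

Lemma isMat_inENbasis G F c i : isMat G F c ->
  inENbasis k n i.+1 c = (#|F| == k + i)%N.
Proof.
move=> /isMat_card[E1 E2]; by rewrite /inENbasis -E2 E1 eqn_add2l andbb.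
Qed.

Lemma isMat_edelOk G F c q : isMat G F c -> q \in F ->
  edelOk c q = (1 < #|erow F q.1|)%N.
Proof.
move=> /isMatP[_ rowF colF] qF; rewrite /edelOk rowF ltnS.
suff -> : q.2 \in c.2 by rewrite andbT.
apply: contraT => nq; have := colF q.2; rewrite (negPf nq) => /eqP.
by rewrite cards_eq0 => /eqP/setP/(_ q); rewrite !inE qF eqxx.
Qed.

Lemma erow_other F q r : q.1 != r -> erow (F :\ q) r = erow F r.
Proof.
move=> ne; apply/setP => x; rewrite !in_erow !inE.
by case: (eqVneq x q) => // ->; rewrite (negPf ne) !andbF.
Qed.

Lemma ecol_setD1 F q l : ecol (F :\ q) l = ecol F l :\ q.
Proof. by apply/setP => x; rewrite !inE; case: (x != q); rewrite ?andbF. Qed.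

Lemma ecol_other F q l : q.2 != l -> ecol (F :\ q) l = ecol F l.
Proof.
move=> ne; apply/setP => x; rewrite !inE.
by case: (eqVneq x q) => // ->; rewrite (negPf ne) !andbF.
Qed.

Lemma isMat_setD1 G F c q : q \in F -> edelOk c q -> q \in G ->
  isMat G F c = isMat G (F :\ q) (edel c q).
Proof.
move=> qF /andP[pos lc] qG.
have rowq : #|erow F q.1| = #|erow (F :\ q) q.1|.+1.
  by rewrite erow_setD1 (cardsD1 q (erow F q.1)) in_erow qF eqxx.
have colq : #|ecol F q.2| = #|ecol (F :\ q) q.2|.+1.
  by rewrite ecol_setD1 (cardsD1 q (ecol F q.2)) inE qF eqxx.
have subE : (F \subset G) = (F :\ q \subset G).
  by rewrite -{1}(setD1K qF) subUset sub1set qG.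
apply/isMatP/isMatP => -[sF rowF colF]; split; rewrite ?subE // -?subE //.
- move=> r; rewrite edel1; have := rowF r; have [->|ne] := eqVneq r q.1.
    by rewrite rowq; move: pos; clear; lia.
  by rewrite erow_other 1?eq_sym // subn0.
- move=> l; rewrite !inE; have := colF l; have [->|ne] := eqVneq l q.2.
    by rewrite colq lc => -[->].
  by rewrite ecol_other 1?eq_sym.
- move=> r; have := rowF r; rewrite edel1; have [->|ne] := eqVneq r q.1.
    by rewrite rowq; move: pos; clear; lia.
  by rewrite erow_other 1?eq_sym // subn0.
- move=> l; have := colF l; rewrite !inE; have [->|ne] := eqVneq l q.2.
    by rewrite colq lc => ->.
  by rewrite ecol_other 1?eq_sym.
Qed.

Lemma isMat_edel_notin G F c q : isMat G F (edel c q) -> q \notin F.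
Proof.
move=> /isMatP[_ _ /(_ q.2)]; rewrite !inE eqxx /= => /eqP.
rewrite cards_eq0 => /eqP/setP/(_ q); rewrite !inE eqxx andbT => ->.
by [].
Qed.

Lemma card_erow F r : (#|erow F r| <= n)%N.
Proof.
rewrite -[X in (_ <= X)%N]card_ord -(card_in_imset (f := fun q : edge => q.2) (D := erow F r)).
  by rewrite max_card.
by move=> [s l] [t j]; rewrite !in_erow /= => /andP[_ /eqP->] /andP[_ /eqP->] ->.
Qed.

(** [inord] does not truncate: the edges in a row of a matching lie in distinct columns, so each
    exponent plus one is at most [n]. *)
Lemma edelOk_eadd G F c q : isMat G F c -> q.2 \notin c.2 ->
  edelOk (eadd c q) q /\ edel (eadd c q) q = c.
Proof.
move=> /isMatP[_ rowF _] nq.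
have E j : (eadd c q).1 j = (c.1 j + (j == q.1))%N :> nat.
  rewrite ffunE inordK //; have := card_erow F j; rewrite rowF.
  by move: (c.1 j : nat) => a; case: (j == q.1) => /=; clear; lia.
split; first by rewrite /edelOk E eqxx addn1 !inE eqxx.
rewrite [RHS]surjective_pairing; congr pair; last by rewrite /= setU1K.
by apply/ffunP => j; apply: ord_inj; rewrite -[LHS]/(((edel (eadd c q) q).1 j) : nat) edel1 E addnK.
Qed.

End BasisElements.

(** * Matrix entries after pruning *)

Section Entries.

Variables (R : comNzRingType) (k n : nat) (Z : {set 'I_k * 'I_n}).

Local Notation edge := ('I_k * 'I_n)%type.
Local Notation A := (S R k n).
Local Notation G := (~: Z).
Implicit Types (c b : ENbasis k n) (q : edge) (F : {set edge}).

Lemma ENentryE i b c : ENentry R k n i.+2 b c =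
  \sum_(q | edelOk c q) if b == edel c q then (-1) ^+ lpos c.2 q.2 * evar R q else 0.
Proof.
rewrite /ENentry pair_big /=; apply: eq_bigr => -[r l] _ /=.
by rewrite edelP.
Qed.

Lemma ENentry_edel i c q : edelOk c q ->
  ENentry R k n i.+2 (edel c q) c = (-1) ^+ lpos c.2 q.2 * evar R q.
Proof.
move=> vq; rewrite ENentryE (bigD1 q) //= eqxx big1 ?addr0 // => q' /andP[vq' ne].
by case: eqP => // /(edel_inj vq vq') E; rewrite E eqxx in ne.
Qed.

Lemma ENentry_neq0 i b c : ENentry R k n i.+2 b c != 0 ->
  exists2 q, edelOk c q & b = edel c q.
Proof.
move=> ne; have [/existsP[q /andP[vq /eqP E]]|none] :=
  boolP [exists q, edelOk c q && (b == edel c q)]; first by exists q.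
case/eqP: ne; rewrite ENentryE big1 // => q vq.
by case: ifP => // E; case/existsP: none; exists q; rewrite vq E.
Qed.

Lemma prunedEntry_edel i c q : edelOk c q -> prunedEntry R k n Z i.+2 (edel c q) c =
  if q \in Z then 0 else (-1) ^+ lpos c.2 q.2 * evar R q.
Proof.
move=> vq; rewrite /prunedEntry ENentry_edel // rmorphMsign /= zeroZ_var.
by case: ifP; rewrite ?mulr0.
Qed.

Lemma prunedEntry_neq0 i b c : prunedEntry R k n Z i.+2 b c != 0 ->
  exists q, [/\ edelOk c q, b = edel c q & q \notin Z].
Proof.
move=> ne; have [|q vq E] := @ENentry_neq0 i b c.
  by apply: contraNneq ne; rewrite /prunedEntry => ->; rewrite raddf0.
exists q; split=> //; apply: contra ne => qZ.
by rewrite E prunedEntry_edel // qZ.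
Qed.

Lemma evar_neq0 q : evar R q != 0.
Proof.
apply/eqP => E; have := pcoef_var q (1 : A) (fplus [ffun _ => 0%N] [set q]).
rewrite mulr1 E pcoef0 pcoef1 !ffunE set11 /= (_ : _ == set0).
  by move=> /eqP; rewrite eq_sym oner_eq0.
by apply/eqP/setP => x; rewrite !inE !ffunE !inE addnK.
Qed.

(** Distinct transversals give distinct monomials, so a pruned minor is nonzero as soon as one
    matching exists. In higher degrees a nonzero entry is an edge outside [Z], and adding or
    deleting it carries matchings between row and column elements. *)
Lemma survE i c : (c \in pruneSurv R k n Z i.+1) =
  inENbasis k n i.+1 c && [exists F, isMat G F c].
Proof.
elim: i c => [|i IH] c; rewrite inE; apply: andb_id2l => cb.
  have c1 r : c.1 r = 0%N :> nat.
    move: cb => /andP[]; rewrite sum_nat_eq0 => /forallP/(_ r) /eqP //.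
  have cardJ : #|c.2| = k by move: cb => /andP[_ /eqP->]; rewrite addn0.
  have [sg H] := pcoef_minor R Z c1 cardJ.
  apply/existsP/existsP => [[r /andP[_ ne]]|[F mF]].
    apply/existsP; apply: contraNT ne => none; apply/eqP.
    apply: pcoef_ext => f; rewrite -[zeroZ _ _ _ _ _]mulr1 H pcoef0 big1 // => F /andP[mF _].
    by case/existsP: none; exists F.
  exists (ENb0 k n); rewrite set11 /=; apply/eqP => E.
  (* At the monomial of [F] no other matching contributes, because all matchings of [c] have equally
     many edges. *)
  have := H 1 (fplus [ffun _ => 0%N] F); rewrite E mul0r pcoef0 (bigD1 F) /=; last first.
    by rewrite mF; apply/subsetP => q qF; rewrite inE ffunE qF addn1.
  rewrite big1 ?addr0.
    rewrite pcoef1 (_ : _ == set0); last first.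
      by apply/eqP/setP => x; rewrite !inE !ffunE addnK.
    by rewrite mulr1 => /eqP; rewrite eq_sym signr_eq0.
  move=> F' /andP[/andP[mF' /subsetP sF'] ne]; rewrite pcoef1.
  case: eqP => [|_]; last by rewrite mulr0.
  case/eqP: ne; apply/eqP; rewrite eqEcard.
  rewrite (isMat_card mF).1 (isMat_card mF').1 leqnn andbT.
  apply/subsetP => q /sF'; rewrite inE ffunE ffunE add0n.
  by case: (q \in F).
apply/existsP/existsP => [[b /andP[bS]]|[F mF]].
  rewrite -/(prunedEntry R k n Z i.+2 b c) => /prunedEntry_neq0[q [vq E qZ]].
  move: bS; rewrite IH => /andP[_ /existsP[F mF]]; subst b.
  have nq := isMat_edel_notin mF.
  exists (q |: F); rewrite (@isMat_setD1 _ _ _ _ _ q) ?setU11 ?setU1K //.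
  by rewrite inE.
have [r rpos] : exists r, (0 < c.1 r)%N.
  apply/existsP; apply: contraT; rewrite negb_exists => /forallP H.
  move: cb => /andP[/eqP]; rewrite big1 // => r _; apply/eqP; rewrite -leqn0 leqNgt; exact: H.
have [q qF qr] : exists2 q, q \in F & q.1 = r.
  have /isMatP[_ /(_ r) rowF _] := mF.
  have /card_gt0P[q] : (0 < #|erow F r|)%N by rewrite rowF.
  by rewrite in_erow => /andP[qF /eqP]; exists q.
have /isMatP[/subsetP sF rowF _] := mF.
have vq : edelOk c q by rewrite (isMat_edelOk mF qF) rowF qr ltnS.
have qG := sF q qF.
exists (edel c q); rewrite IH -inENbasis_edel // cb /=; apply/andP; split.
  by apply/existsP; exists (F :\ q); rewrite -isMat_setD1.
rewrite -[_ != 0]/(prunedEntry R k n Z i.+2 (edel c q) c != 0) prunedEntry_edel // ifN; last first.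
  by move: qG; rewrite inE.
by rewrite -signr_odd mulr_sign; case: ifP; rewrite ?oppr_eq0 evar_neq0.
Qed.

End Entries.

(** Antisymmetry alone gives only twice a diagonal term equal to zero, hence the hypothesis at equal
    keys. Elsewhere the key orders each transposed pair so that it cancels. *)
Lemma antisym_sum_eq0 (V : zmodType) (I : finType) (key : I -> nat) (T : I -> I -> V) :
  (forall i j, T i j = - T j i) -> (forall i j, key i = key j -> T i j = 0) ->
  \sum_i \sum_j T i j = 0.
Proof.
move=> anti diag; rewrite pair_big /= (bigID (fun x : I * I => key x.1 < key x.2)%N) /=.
rewrite [X in _ + X](bigID (fun x : I * I => key x.2 < key x.1)%N) /=.
rewrite [X in _ + (_ + X)]big1 ?addr0; last first.
  by move=> [i j] /=; rewrite -!leqNgt => /andP[le1 le2]; apply: diag; lia.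
pose sw (x : I * I) := (x.2, x.1).
rewrite [X in _ + X](reindex sw) /=; last by apply: onW_bij; exists sw => -[].
apply/eqP; rewrite addr_eq0 -sumrN; apply/eqP; apply: eq_big => [[i j]|[i j] _] /=.
  by rewrite -leqNgt; case: ltngtP.
exact: anti.
Qed.

(** * Differentials compose to zero *)

Section Complex.

Variables (R : comNzRingType) (k n : nat) (Z : {set 'I_k * 'I_n}).

Local Notation edge := ('I_k * 'I_n)%type.
Local Notation A := (S R k n).
Local Notation G := (~: Z).
Implicit Types (c b : ENbasis k n) (q : edge) (F : {set edge}).

Lemma sum_ENentry i (h : ENbasis k n -> A) c' :
  \sum_c h c * ENentry R k n i.+2 c c' =
  \sum_(q | edelOk c' q) h (edel c' q) * ((-1) ^+ lpos c'.2 q.2 * evar R q).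
Proof.
rewrite (eq_bigr (fun c => \sum_(q | edelOk c' q) (if c == edel c' q then
   h c * ((-1) ^+ lpos c'.2 q.2 * evar R q) else 0))).
  rewrite exchange_big; apply: eq_bigr => q _ /=.
  by rewrite -big_mkcond /= big_pred1_eq.
move=> c _; rewrite ENentryE mulr_sumr; apply: eq_bigr => q _.
by case: ifP; rewrite ?mulr0.
Qed.

Lemma edel_comm c q q' : edel (edel c q) q' = edel (edel c q') q.
Proof.
rewrite [LHS]surjective_pairing [RHS]surjective_pairing; congr pair; last first.
  by rewrite /= setDDl setUC -setDDl.
by apply/ffunP => j; apply: ord_inj; rewrite !edel1 -!subnDA addnC.
Qed.

Lemma ENentry_dd i b c' : inENbasis k n i.+2 c' ->
  \sum_c ENentry R k n i.+1 b c * ENentry R k n i.+2 c c' = 0.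
Proof.
move=> c'b; rewrite sum_ENentry; case: i c'b => [|i] c'b.
  have cardL : #|c'.2| = k.+1 by move: c'b => /andP[_ /eqP->]; rewrite addn1.
  rewrite (eq_bigl (fun q : edge => (0 < c'.1 q.1)%N && (q.2 \in c'.2))) //.
  rewrite -(pair_big (fun r => 0 < c'.1 r)%N (fun l => l \in c'.2) (fun r l =>
    ENentry R k n 1 b (edel c' (r, l)) * ((-1) ^+ lpos c'.2 l * evar R (r, l)))) /=.
  rewrite big1 // => r _.
  have := minor_laplace (genX R k n) r cardL; rewrite -[RHS](mulr0 1) => E.
  rewrite -[RHS](mulr0 1) -E; apply: eq_bigr => l _.
  by rewrite mulrC.
rewrite (eq_bigr (fun q => \sum_q' if edelOk c' q && edelOk (edel c' q) q' then
   (if b == edel (edel c' q) q' then (-1) ^+ (lpos (edel c' q).2 q'.2 + lpos c'.2 q.2) *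
      (evar R q' * evar R q) else 0) else 0)); last first.
  move=> q vq; rewrite ENentryE mulr_suml big_mkcond /=; apply: eq_bigr => q' _.
  rewrite vq /=; case: ifP => // _; case: ifP => _; last by rewrite mul0r.
  by rewrite exprD mulrACA.
rewrite big_mkcond /=.
rewrite (eq_bigr (fun q => \sum_q' if edelOk c' q && edelOk (edel c' q) q' then
   (if b == edel (edel c' q) q' then (-1) ^+ (lpos (edel c' q).2 q'.2 + lpos c'.2 q.2) *
      (evar R q' * evar R q) else 0) else 0)); last first.
  by move=> q _; case: (edelOk c' q) => //=; rewrite big1.
have ok2 q q' : edelOk c' q && edelOk (edel c' q) q' =
   [&& 0 < c'.1 q.1, 0 < c'.1 q'.1 - (q'.1 == q.1), q.2 \in c'.2, q'.2 \in c'.2 & q'.2 != q.2]%N.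
  rewrite /edelOk edel1 !inE; case: (0 < c'.1 q.1)%N; case: (q.2 \in c'.2) => //=; rewrite ?andbF //.
  by rewrite andbC [_ && (q'.2 \in _)]andbC; case: (0 < _)%N; rewrite ?andbT ?andbF.
(* The two orders of deleting two columns have opposite signs; the column serves as key because none
   can be deleted twice. *)
apply: (antisym_sum_eq0 (key := fun q : edge => nat_of_ord q.2)) => q q'; last first.
  by move=> /ord_inj E; rewrite ok2 E eqxx !andbF.
rewrite edel_comm !ok2.
have -> : [&& 0 < c'.1 q'.1, 0 < c'.1 q.1 - (q.1 == q'.1), q'.2 \in c'.2, q.2 \in c'.2 & q.2 != q'.2]%N =
  [&& 0 < c'.1 q.1, 0 < c'.1 q'.1 - (q'.1 == q.1), q.2 \in c'.2, q'.2 \in c'.2 & q'.2 != q.2]%N.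
  rewrite [q.2 == _]eq_sym [q.1 == _]eq_sym; case: (eqVneq q'.1 q.1) => [->|_].
    by apply/and5P/and5P => -[? ? ? ? ?]; split.
  by rewrite !subn0; apply/and5P/and5P => -[? ? ? ? ?]; split.
case: ifP => [/and5P[_ _ lL lL' ne]|_]; last by rewrite oppr0.
case: ifP => _; last by rewrite oppr0.
rewrite [evar R q' * _]mulrC -mulNr; congr (_ * _).
have := lpos_setD1 q.2 lL'; have := lpos_setD1 q'.2 lL => /= -> ->.
rewrite !exprD; case: (ltngtP (nat_of_ord q.2) q'.2) => [lt|lt|/ord_inj E] /=.
- by rewrite expr0 expr1 mulr1 mulrN1 mulrN opprK mulrC.
- by rewrite expr0 expr1 mulr1 mulrN1 mulrN mulrC.
- by rewrite E eqxx in ne.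
Qed.

Lemma inENbasis_prunedEntry i c c' : inENbasis k n i.+2 c' ->
  prunedEntry R k n Z i.+2 c c' != 0 -> inENbasis k n i.+1 c.
Proof.
by move=> c'b /prunedEntry_neq0[q [vq -> _]]; rewrite -inENbasis_edel.
Qed.

(** An omitted [c] adds nothing to the full sum: nonzero entries on both sides, with [b] surviving,
    would make [c] survive. *)
Lemma pruned_dd i b c' : b \in pruneSurv R k n Z i -> c' \in pruneSurv R k n Z i.+2 ->
  \sum_(c in pruneSurv R k n Z i.+1)
     prunedEntry R k n Z i.+1 b c * prunedEntry R k n Z i.+2 c c' = 0.
Proof.
move=> bS; rewrite survE => /andP[c'b _].
rewrite big_mkcond /=.
rewrite (eq_bigr (fun c => zeroZ R k n Z (ENentry R k n i.+1 b c * ENentry R k n i.+2 c c'))).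
  by rewrite -rmorph_sum ENentry_dd //= raddf0.
move=> c _; rewrite rmorphM; case: ifP => // /negbT; apply: contraNeq => ne.
have ne1 : prunedEntry R k n Z i.+1 b c != 0.
  by apply: contraNneq ne; rewrite /prunedEntry => /= ->; rewrite mul0r.
have ne2 : prunedEntry R k n Z i.+2 c c' != 0.
  by apply: contraNneq ne; rewrite /prunedEntry => /= ->; rewrite mulr0.
rewrite inE; apply/andP; split; first exact: (inENbasis_prunedEntry c'b ne2).
by apply/existsP; exists b; rewrite bS.
Qed.

End Complex.

(** * Ranks of monomial multiples of basis elements *)

Section OptimalMatchings.

Variables (k n : nat) (G : {set 'I_k * 'I_n}).

Local Notation edge := ('I_k * 'I_n)%type.
Implicit Types (c b : ENbasis k n) (q : edge) (F : {set edge}) (f m : {ffun edge -> nat}).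

Definition matchable c : bool := [exists F, isMat G F c].

Definition optMat c : {set edge} :=
  odflt set0 [pick F | isMat G F c && [forall F', isMat G F' c ==> (cost F <= cost F')%N]].

Lemma optMatP c : matchable c ->
  isMat G (optMat c) c /\ forall F', isMat G F' c -> (cost (optMat c) <= cost F')%N.
Proof.
move=> /existsP[F0 mF0]; rewrite /optMat; case: pickP => [F /andP[mF /forallP H]|none].
  by split=> // F' mF'; have := H F'; rewrite mF'.
case: (@arg_minnP _ F0 (fun F => isMat G F c) (@cost k n) mF0) => F mF minF.
have := none F; rewrite mF => /negbT/negP[]; apply/forallP => F'.
by apply/implyP => /minF.
Qed.

Lemma optMat_sec c : matchable c -> optMat c \subset sec G (potf G (optMat c)).
Proof. by move=> /optMatP[mF minF]; rewrite sec_potf; apply: min_cost_sec mF minF. Qed.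

Lemma isMat_matchable F c : isMat G F c -> matchable c.
Proof. by move=> mF; apply/existsP; exists F. Qed.

(** Lying in a sector, whatever its potential, certifies optimality and uniqueness through
    [sec_min_cost]. *)
Lemma optMat_unique F c u : isMat G F c -> F \subset sec G u -> optMat c = F.
Proof.
move=> mF sF; have [mO /(_ F mF) minO] := optMatP (isMat_matchable mF).
by have [le] := sec_min_cost mF sF mO; rewrite eqn_leq le minO => /esym/eqP.
Qed.

Lemma optMat_lt F c : isMat G F c -> F != optMat c -> (cost (optMat c) < cost F)%N.
Proof.
move=> mF ne; have mc := isMat_matchable mF; have [mO _] := optMatP mc.
by rewrite (ltn_leqif (sec_min_cost mO (optMat_sec mc) mF)).
Qed.

Lemma isMat_inj F c c' : isMat G F c -> isMat G F c' -> c = c'.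
Proof.
move=> /isMatP[_ rowF colF] /isMatP[_ rowF' colF'].
rewrite [c]surjective_pairing [c']surjective_pairing; congr pair.
  by apply/ffunP => r; apply: ord_inj; have := rowF r; rewrite rowF' => -[].
apply/setP => l; have := colF l; rewrite colF'.
by case: (l \in c.2); case: (l \in c'.2).
Qed.

Definition fcost f : nat := (\sum_q f q * wgt q)%N.
Definition fdeg f : nat := (\sum_q f q)%N.

Lemma fcost_fplus f F : fcost (fplus f F) = (fcost f + cost F)%N.
Proof.
rewrite /fcost /cost [X in (_ + X)%N]big_mkcond -big_split /=.
apply: eq_bigr => q _; rewrite ffunE mulnDl.
by case: (q \in F); rewrite ?mul1n.
Qed.

Lemma fdeg_fplus f F : fdeg (fplus f F) = (fdeg f + #|F|)%N.
Proof.
rewrite /fdeg -sum1_card [X in (_ + X)%N]big_mkcond -big_split /=.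
by apply: eq_bigr => q _; rewrite ffunE; case: (q \in F).
Qed.

Lemma cost_set1 q : cost [set q] = wgt q.
Proof. by rewrite /cost big_set1. Qed.

Lemma fplusK F f : fminus (fplus f F) F = f.
Proof. by apply/ffunP => q; rewrite !ffunE addnK. Qed.

Lemma fminusK F f : F \subset msupp f -> fplus (fminus f F) F = f.
Proof.
move=> /subsetP sF; apply/ffunP => q; rewrite !ffunE.
case qF: (q \in F); last by rewrite subn0 addn0.
by have := sF q qF; rewrite inE => fq; rewrite subnK.
Qed.

Lemma fplus_setU1 f F q : q \notin F -> fplus f (q |: F) = fplus (fplus f [set q]) F.
Proof.
move=> qF; apply/ffunP => x; rewrite !ffunE !inE -addnA; congr addn.
by case: (eqVneq x q) => [->|]; rewrite ?(negPf qF).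
Qed.

Definition wtot : nat := (\sum_(q : edge) wgt q)%N.

Lemma cost_le F : (cost F <= wtot)%N.
Proof. by rewrite /cost /wtot [X in (_ <= X)%N](bigID (mem F)) /= leq_addr. Qed.

Lemma fcost_le f : (fcost f <= fdeg f * wtot)%N.
Proof.
rewrite /fcost /fdeg big_distrl /=; apply: leq_sum => q _.
by rewrite leq_mul2l -cost_set1 cost_le orbT.
Qed.

Definition top c f : {ffun edge -> nat} := fplus f (optMat c).

Lemma cell_top c f : matchable c -> cell G (top c f) (optMat c).
Proof.
move=> mc; have [mF _] := optMatP mc; have /isMatP[_ rowF _] := mF.
apply/cellP; split; last by move=> r; rewrite -card_gt0 rowF.
  by apply/subsetP => q qF; rewrite inE ffunE qF addn1.
exact: optMat_sec.
Qed.

Definition toggleAt c f : option edge := toggle G (top c f) (optMat c).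

(** Marks the member of a pair that lacks the toggled edge; its partner lies one homological degree
    higher. *)
Definition lowerAt c f : bool := if toggleAt c f is Some q then q \notin optMat c else false.

Definition rankAt c f : nat :=
  (fcost (top c f) * cellRank_bound k n + cellRank G (top c f) (optMat c))%N.

Definition rankAt_bound (d : nat) : nat := ((d.+1 * wtot).+1 * cellRank_bound k n)%N.

Lemma rankAt_lt c f d : (fdeg f <= d)%N -> (rankAt c f < rankAt_bound d)%N.
Proof.
move=> fd; rewrite /rankAt /rankAt_bound fcost_fplus.
have := cellRank_lt G (top c f) (optMat c); have := cost_le (optMat c).
have : (fcost f <= d * wtot)%N by rewrite (leq_trans (fcost_le f)) // leq_mul2r fd orbT.
move: (fcost f) (cost _) (cellRank _ _ _) (cellRank_bound _ _) wtot => a b x B W.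
by clear; nia.
Qed.

Lemma toggleAt_edel c f q : matchable c -> toggleAt c f = Some q -> q \in optMat c ->
  [/\ edelOk c q, q \in G, matchable (edel c q) & optMat (edel c q) = optMat c :\ q].
Proof.
move=> mc tq qF; have [mF _] := optMatP mc; have /isMatP[/subsetP sG _ _] := mF.
have [r [_ _ qr ne]] := toggleP tq; have qG := sG q qF.
have vq : edelOk c q.
  rewrite (isMat_edelOk mF qF) qr (cardsD1 q (erow _ _)) in_erow qF qr eqxx add1n ltnS.
  rewrite card_gt0; apply: contra ne; rewrite setD_eq0 subset1 => /orP[//|/eqP E].
  by have : q \in erow (optMat c) r; [rewrite in_erow qF qr eqxx | rewrite E inE].
have mF' : isMat G (optMat c :\ q) (edel c q) by rewrite -isMat_setD1.
split=> //; first exact: isMat_matchable mF'.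
by apply: optMat_unique mF' (subset_trans (subD1set _ _) (optMat_sec mc)).
Qed.

(** Acyclicity: [c'] is another source of the face paired with [c]. Exchanging [q] for [q1] in the
    matching of [c] gives a matching of [c'] over the same monomial. If it is not optimal, the
    weight of the top monomial drops; otherwise [toggle_rank_lt] applies. *)
Lemma rankAt_decr c f q c' f' q' q1 : matchable c -> matchable c' ->
  toggleAt c f = Some q -> q \in optMat c ->
  toggleAt c' f' = Some q' -> q' \in optMat c' ->
  edelOk c' q1 -> q1 \in G -> edel c' q1 = edel c q ->
  fplus f' [set q1] = fplus f [set q] -> c' != c -> (rankAt c' f' < rankAt c f)%N.
Proof.
move=> mc mc' tq qF tq' qF' v1 q1G Ec Ef ne.
have [vq qG mb optb] := toggleAt_edel mc tq qF.
have [mF _] := optMatP mc; have [mF' minF'] := optMatP mc'.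
set F := optMat c in qF optb mF *; set F' := optMat c' in qF' mF' minF' *.
have mB : isMat G (F :\ q) (edel c' q1) by rewrite Ec -optb; have [] := optMatP mb.
have nq1 := isMat_edel_notin mB.
have mF1 : isMat G (q1 |: F :\ q) c'.
  by rewrite (@isMat_setD1 _ _ _ _ _ q1) ?setU11 ?setU1K.
have topE : fplus f' (q1 |: F :\ q) = top c f.
  rewrite fplus_setU1 // Ef -fplus_setU1 ?setD1K //.
  by rewrite !inE eqxx.
have [E1|ne1] := eqVneq (q1 |: F :\ q) F'; last first.
  have lt := optMat_lt mF1 ne1.
  have : (fcost (top c' f') < fcost (top c f))%N.
    by rewrite -topE !fcost_fplus ltn_add2l.
  have := cellRank_lt G (top c' f') F'; rewrite /rankAt -/F -/F'.
  move: (cellRank _ _ _) (cellRank _ _ _) (cellRank_bound _ _) (fcost _) (fcost _) => x y B a b.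
  by clear; nia.
have topE' : top c' f' = top c f by rewrite -topE E1.
rewrite /rankAt topE' ltn_add2l -/F -/F'.
have nq : q \notin F'.
  rewrite -E1 !inE eqxx orbF; apply: contraNneq ne => E.
  by apply/eqP/(isMat_inj mF1); rewrite -E setD1K.
have sub : F :\ q \subset F' by rewrite -E1 subsetUr.
have cell' : cell G (top c f) F' by rewrite -topE'; exact: cell_top.
have tog' : toggle G (top c f) F' = Some q' by rewrite -topE'; exact: tq'.
exact: toggle_rank_lt (cell_top f mc) tq qF cell' sub nq tog' qF'.
Qed.

Lemma lowerAt_partner c f : matchable c -> lowerAt c f -> exists q c' f',
  [/\ toggleAt c' f' = Some q /\ q \in optMat c', matchable c', edelOk c' q, edel c' q = c &
      fplus f' [set q] = f].
Proof.
rewrite /lowerAt => mc; case tq: toggleAt => [q|//] qF.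
have [mF _] := optMatP mc.
have [cellA potA togA] := toggle_add (cell_top f mc) tq qF.
have /cellP[_ secA _] := cellA.
have qsec : q \in sec G (potf G (q |: optMat c)) by apply: (subsetP secA); rewrite setU11.
have qG := subsetP (sec_sub _ _) _ qsec.
(* Otherwise column [q.2] would hold two edges of one sector, which must coincide, placing [q] in
   the matching. *)
have nq : q.2 \notin c.2.
  apply/negP => qc; have /isMatP[_ _ /(_ q.2)] := mF; rewrite qc => /eqP/cards1P[[s l] E].
  have : (s, l) \in ecol (optMat c) q.2 by rewrite E set11.
  rewrite inE /= => /andP[slF /eqP El]; subst l; case/negP: qF.
  rewrite [q]surjective_pairing -(@sec_col_inj _ _ G (potf G (q |: optMat c)) s q.1 q.2) //.
    by apply: (subsetP secA); rewrite inE slF orbT.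
  by rewrite -surjective_pairing.
have [vq Eq] := edelOk_eadd mF nq.
have mA : isMat G (q |: optMat c) (eadd c q).
  by rewrite (@isMat_setD1 _ _ _ _ _ q) ?setU11 ?setU1K // Eq.
have optA : optMat (eadd c q) = q |: optMat c by apply: optMat_unique mA secA.
(* The pivot divides [top c f] but is not in the matching, so it divides [f]. *)
have fq : (0 < f q)%N.
  have [r [_ pv _ _]] := toggleP tq; have [qa _ _] := pivotP pv; move: qa.
  by rewrite inE => /andP[_]; rewrite inE ffunE (negPf qF) addn0.
exists q, (eadd c q), (fminus f [set q]).
have Ef : fplus (fminus f [set q]) [set q] = f.
  by apply: fminusK; rewrite sub1set inE.
split; [ | exact: isMat_matchable mA | exact: vq | exact: Eq | exact: Ef ].
split; last by rewrite optA setU11.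
by rewrite /toggleAt /top optA (fplus_setU1 _ qF) Ef; exact: togA.
Qed.

Lemma critical_card c f : matchable c -> toggleAt c f = None -> #|optMat c| = k.
Proof.
move=> mc tN; have := sum_edge_row (optMat c) (fun _ => 1%N); rewrite sum1_card => ->.
rewrite (eq_bigr (fun _ => 1%N)) ?sum1_card ?card_ord // => r _.
by rewrite (critical_row r (cell_top f mc) tN).
Qed.

End OptimalMatchings.

(** * Exactness *)

Section Exactness.

Variables (R : comNzRingType) (k n : nat) (Z : {set 'I_k * 'I_n}).

Local Notation edge := ('I_k * 'I_n)%type.
Local Notation A := (S R k n).
Local Notation G := (~: Z).
Local Notation Surv := (pruneSurv R k n Z).
Local Notation papply := (prunedApply R k n Z).
Implicit Types (c b : ENbasis k n) (q : edge) (F : {set edge}) (f m : {ffun edge -> nat}).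
Implicit Types (v w : ENbasis k n -> A).

Lemma surv_matchable i c : c \in Surv i.+1 -> matchable G c.
Proof. by rewrite survE => /andP[]. Qed.

Lemma surv_card i c : c \in Surv i.+1 -> #|optMat G c| = (k + i)%N.
Proof.
rewrite survE => /andP[cb mc]; have [mF _] := optMatP mc.
by move: cb; rewrite (isMat_inENbasis _ mF) => /eqP.
Qed.

Lemma surv_edel i c q : edelOk c q -> matchable G (edel c q) -> c \in Surv i.+2 ->
  edel c q \in Surv i.+1.
Proof.
by move=> vq mc; rewrite !survE -inENbasis_edel // => /andP[-> _].
Qed.

Lemma surv_of_edel i c q : edelOk c q -> matchable G c -> edel c q \in Surv i.+1 ->
  c \in Surv i.+2.
Proof.
by move=> vq mc; rewrite !survE -inENbasis_edel // => /andP[-> _].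
Qed.

Lemma pcoef_entry_edel i c q (p : A) f : edelOk c q -> q \in G ->
  pcoef (prunedEntry R k n Z i.+2 (edel c q) c * p) f =
  (-1) ^+ lpos c.2 q.2 * (if (0 < f q)%N then pcoef p (fminus f [set q]) else 0).
Proof.
move=> vq; rewrite inE => qZ; rewrite prunedEntry_edel // (negPf qZ).
by rewrite -mulrA pcoef_sign pcoef_var.
Qed.

Lemma toggle_not_none i c f : c \in Surv i.+2 -> toggleAt G c f <> None.
Proof.
move=> cS /(critical_card (surv_matchable cS)) E.
by have := surv_card cS; rewrite E; lia.
Qed.

(** Induction on the rank: in the cycle condition at the face paired with [c], every other source
    already has coefficient zero, and [c] enters with a unit. *)
Lemma cycle_no_lower i v : (forall c f, c \in Surv i.+2 -> lowerAt G c f -> pcoef (v c) f = 0) ->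
  (forall b, b \in Surv i.+1 -> papply i.+2 v b = 0) ->
  forall c, c \in Surv i.+2 -> v c = 0.
Proof.
move=> nolow cyc.
suff gen N c f : (rankAt G c f < N)%N -> c \in Surv i.+2 -> pcoef (v c) f = 0.
  by move=> c cS; apply: pcoef_ext => f; rewrite pcoef0 (gen (rankAt G c f).+1).
elim: N c f => // N IH c f; rewrite ltnS => rkN cS.
have mc := surv_matchable cS.
case tq: (toggleAt G c f) => [q|]; last by case: (toggle_not_none cS tq).
have [qF|qF] := boolP (q \in optMat G c); last first.
  by apply: nolow => //; rewrite /lowerAt tq.
have [vq qG mb optb] := toggleAt_edel mc tq qF.
have bS := surv_edel vq mb cS.
have := congr1 (fun p => pcoef p (fplus f [set q])) (cyc _ bS).
rewrite pcoef0 /prunedApply pcoef_sum (bigD1 c) //= big1 ?addr0.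
  rewrite pcoef_entry_edel // ffunE set11 addn1 /= fplusK => /eqP.
  by rewrite mulrI_eq0 => [/eqP|]; last exact: lreg_sign.
move=> c' /andP[c'S ne].
have [->|nz] := eqVneq (prunedEntry R k n Z i.+2 (edel c q) c') 0.
  by rewrite mul0r pcoef0.
have [q1 [v1 E1 q1Z]] := prunedEntry_neq0 nz.
have q1G : q1 \in G by rewrite inE.
rewrite E1 pcoef_entry_edel //; case: ifP => [pos|]; last by rewrite mulr0.
set f' := fminus _ _.
have Ef' : fplus f' [set q1] = fplus f [set q] by apply: fminusK; rewrite sub1set inE.
suff -> : pcoef (v c') f' = 0 by rewrite mulr0.
have mc' := surv_matchable c'S.
case tq': (toggleAt G c' f') => [q'|]; last by case: (toggle_not_none c'S tq').
have [qF'|qF'] := boolP (q' \in optMat G c'); last first.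
  by apply: nolow => //; rewrite /lowerAt tq'.
apply: IH => //; apply: leq_trans rkN.
exact: (rankAt_decr mc mc' tq qF tq' qF' v1 q1G (esym E1) Ef' ne).
Qed.

Lemma level1 c : c \in Surv 1 -> (forall r, c.1 r = 0%N :> nat) /\ #|c.2| = k.
Proof.
rewrite survE => /andP[/andP[s0 /eqP E] _]; rewrite addn0 in E; split=> // r.
by move: s0; rewrite sum_nat_eq0 => /forallP/(_ r)/eqP.
Qed.

(** In degree 1 all exponents vanish, so no edge can be deleted and whatever is not lower is
    critical. The cycle condition at [m] isolates it: nonoptimal matchings lead to smaller top
    weight, and optimal ones to lower members or to the unique critical cell over [m]. *)
Lemma cycle_no_lower1 v : (forall c f, c \in Surv 1 -> lowerAt G c f -> pcoef (v c) f = 0) ->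
  papply 1 v (ENb0 k n) = 0 -> forall c, c \in Surv 1 -> v c = 0.
Proof.
move=> nolow cyc.
suff gen N c f : (fcost (top G c f) < N)%N -> c \in Surv 1 -> pcoef (v c) f = 0.
  by move=> c cS; apply: pcoef_ext => f; rewrite pcoef0 (gen (fcost (top G c f)).+1).
elim: N c f => // N IH c f; rewrite ltnS => rkN cS.
have crit c' f' : c' \in Surv 1 -> lowerAt G c' f' \/ toggleAt G c' f' = None.
  move=> c'S; have mc' := surv_matchable c'S; rewrite /lowerAt.
  case tq: (toggleAt G c' f') => [q|]; [left|by right]; apply/negP => qF.
  have [/andP[pos _] _ _ _] := toggleAt_edel mc' tq qF.
  by have [c1 _] := level1 c'S; rewrite c1 in pos.
have mc := surv_matchable cS; have [mF _] := optMatP mc.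
case: (crit c f cS) => [/nolow->//|tN].
set m := top G c f.
have term0 c' F : c' \in Surv 1 -> isMat G F c' -> F \subset msupp m -> (c', F) != (c, optMat G c) ->
    pcoef (v c') (fminus m F) = 0.
  move=> c'S mF' sF ne; have mc' := surv_matchable c'S.
  have [EF|neF] := eqVneq F (optMat G c'); last first.
    apply: IH => //; apply: leq_trans rkN.
    rewrite -[X in (_ < fcost X)%N](fminusK sF) !fcost_fplus ltn_add2l.
    exact: optMat_lt.
  have topE : top G c' (fminus m F) = m by rewrite /top -EF fminusK.
  case: (crit c' (fminus m F) c'S) => [/nolow->//|tN'].
  have E : optMat G c' = optMat G c.
    apply: (critical_unique (cell_top _ mc') tN'); rewrite topE; last exact: tN.
    exact: cell_top.
  case/eqP: ne; rewrite EF E; congr pair; apply: (isMat_inj (F := F) mF').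
  by rewrite EF E.
have := congr1 (fun p => pcoef p m) cyc.
rewrite pcoef0 /prunedApply pcoef_sum (bigD1 c) //= big1 ?addr0.
  have [c1 c2] := level1 cS; have [sg ->] := pcoef_minor R Z c1 c2.
  have sO : optMat G c \subset msupp m.
    by apply/subsetP => q qF; rewrite inE ffunE qF addn1.
  rewrite (bigD1 (optMat G c)) ?mF //= big1 ?addr0.
    by rewrite fplusK => /eqP; rewrite mulrI_eq0 => [/eqP|]; last exact: lreg_sign.
  move=> F /andP[/andP[mF' sF] ne]; rewrite term0 ?mulr0 //.
  by apply: contra ne => /eqP[->].
move=> c' /andP[c'S ne]; have [c1 c2] := level1 c'S; have [sg ->] := pcoef_minor R Z c1 c2.
rewrite big1 // => F /andP[mF' sF]; rewrite term0 ?mulr0 //.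
by apply: contra ne => /eqP[->].
Qed.

(** * Elimination of lower coefficients *)

Lemma pterm_opp (a : R) f : pterm (- a) f = - pterm a f.
Proof. by apply: pcoef_ext => g; rewrite pcoefN !pcoef_term; case: ifP; rewrite ?oppr0. Qed.

Definition reducible i v : Prop := exists w, vecT R k n Z w /\
  forall c f, c \in Surv i.+1 -> lowerAt G c f -> pcoef (v c - papply i.+2 w c) f = 0.

Definition single c (p : A) : ENbasis k n -> A := fun c' => if c' == c then p else 0.

Lemma vecT0 : vecT R k n Z (fun _ => 0). Proof. by move=> c; apply: inT0. Qed.

Lemma vecT_single c p : inT R k n Z p -> vecT R k n Z (single c p).
Proof. by move=> Tp c'; rewrite /single; case: ifP => // _; apply: inT0. Qed.

Lemma papply0 i c : papply i (fun _ => 0) c = 0.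
Proof. by rewrite /prunedApply big1 // => c' _; rewrite mulr0. Qed.

Lemma papplyD i v w c : papply i (fun c' => v c' + w c') c = papply i v c + papply i w c.
Proof. by rewrite /prunedApply -big_split /=; apply: eq_bigr => c' _; rewrite mulrDr. Qed.

Lemma papplyB i v w c : papply i (fun c' => v c' - w c') c = papply i v c - papply i w c.
Proof. by rewrite /prunedApply -sumrB; apply: eq_bigr => c' _; rewrite mulrBr. Qed.

Lemma papply_single i c p b : c \in Surv i ->
  papply i (single c p) b = prunedEntry R k n Z i b c * p.
Proof.
move=> cS; rewrite /prunedApply (bigD1 c) //= /single eqxx big1 ?addr0 // => c' /andP[_ /negbTE->].
by rewrite mulr0.
Qed.

Lemma reducible_ext i v v' : (forall c, c \in Surv i.+1 -> v c = v' c) ->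
  reducible i v -> reducible i v'.
Proof.
by move=> E [w [Tw H]]; exists w; split=> // c f cS low; rewrite -E // H.
Qed.

Lemma reducibleD i v v' : reducible i v -> reducible i v' ->
  reducible i (fun c => v c + v' c).
Proof.
move=> [w [Tw H]] [w' [Tw' H']]; exists (fun c => w c + w' c); split.
  by move=> c; apply: inTD.
move=> c f cS low; rewrite papplyD opprD addrACA pcoefD H // H' //.
by rewrite addr0.
Qed.

Lemma reducible0 i : reducible i (fun _ => 0).
Proof.
exists (fun _ => 0); split; first exact: vecT0.
by move=> c f _ _; rewrite papply0 subr0 pcoef0.
Qed.

Lemma reducible_papply i w : vecT R k n Z w -> reducible i (papply i.+2 w).
Proof. by move=> Tw; exists w; split=> // c f _ _; rewrite subrr pcoef0. Qed.

Lemma reducible_split i v : (forall c, c \in Surv i.+1 -> reducible i (single c (v c))) ->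
  reducible i v.
Proof.
move=> H.
suff gen (s : seq (ENbasis k n)) : reducible i (fun c' => \sum_(c <- s) single c (v c) c').
  apply: reducible_ext (gen (index_enum (ENbasis k n))) => c _.
  by rewrite (bigD1 c) //= /single eqxx big1 ?addr0 // => c' /negbTE; rewrite eq_sym => ->.
elim: s => [|c s IH].
  by apply: reducible_ext (reducible0 i) => c _; rewrite big_nil.
have Rc : reducible i (single c (v c)).
  have [/H//|cS] := boolP (c \in Surv i.+1).
  apply: reducible_ext (reducible0 i) => c' c'S; rewrite /single.
  by case: eqP => // E; rewrite -E c'S in cS.
by apply: reducible_ext (reducibleD Rc IH) => c' _; rewrite big_cons.
Qed.

Lemma reducible_not_lower i c f a : ~~ lowerAt G c f -> reducible i (single c (pterm a f)).
Proof.
move=> nlow; exists (fun _ => 0); split; first exact: vecT0.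
move=> c' f' _ low; rewrite papply0 subr0 /single; case: eqP => [E|_]; last exact: pcoef0.
rewrite pcoef_term; case: eqP => // Ef.
by rewrite Ef -E low in nlow.
Qed.

Lemma msupp_fplus f F : msupp (fplus f F) = msupp f :|: F.
Proof. by apply/setP => q; rewrite !inE ffunE addn_gt0; case: (q \in F). Qed.

(** Subtracting a boundary of the partner leaves its other faces, whose own partners have larger
    rank by [rankAt_decr]. The degree [d] is preserved, so ranks stay below [rankAt_bound k n d],
    and [N] controls the remaining distance. *)
Lemma reducible_term i d N c f a : c \in Surv i.+1 -> fdeg f = d -> msupp f \subset G ->
  (forall q c' f', matchable G c' -> toggleAt G c' f' = Some q -> q \in optMat G c' ->
     edelOk c' q -> edel c' q = c -> fplus f' [set q] = f ->
     (rankAt_bound k n d - rankAt G c' f' < N)%N) ->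
  reducible i (single c (pterm a f)).
Proof.
elim: N c f a => [|N IH] c f a cS fd sf HN;
  (have [low|nlow] := boolP (lowerAt G c f); last exact: reducible_not_lower);
  have [q [c' [f' [[tq qF] mc' vq Ec Ef]]]] := lowerAt_partner (surv_matchable cS) low.
  by have := HN _ _ _ mc' tq qF vq Ec Ef; rewrite ltn0.
have lt := HN _ _ _ mc' tq qF vq Ec Ef.
have f'd : (fdeg f' < d)%N by rewrite -fd -Ef fdeg_fplus cards1 addn1.
have sf' : msupp f' \subset G /\ q \in G.
  by move: sf; rewrite -Ef msupp_fplus subUset sub1set => /andP[].
have c'S : c' \in Surv i.+2 by apply: (surv_of_edel vq mc'); rewrite Ec.
(* The sign of the entry from [c'] to [c] is its own inverse, so the boundary takes the value
   [pterm a f] at [c]. *)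
pose s : R := (-1) ^+ lpos c'.2 q.2.
pose p := pterm (s * a) f'.
have Tp : inT R k n Z p by apply: inT_pterm; case: sf'.
pose v1 b := if b == c then 0 else - (prunedEntry R k n Z i.+2 b c' * p).
apply: (@reducible_ext i (fun b => v1 b + papply i.+2 (single c' p) b)).
  move=> b bS; rewrite papply_single // /v1 /single; case: eqP => [->|_]; last by rewrite addNr.
  rewrite add0r -Ec prunedEntry_edel // ifN; last by case: sf' => _; rewrite inE.
  rewrite -mulrA var_pterm sign_pterm Ef mulrA /s -expr2 sqrr_sign mul1r //.
apply: reducibleD; last by apply: reducible_papply; apply: vecT_single.
apply: reducible_split => b bS.
have R0 : reducible i (single b 0).
  by apply: reducible_ext (reducible0 i) => x _; rewrite /single if_same.
rewrite /v1; case: eqP => // /eqP ne.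
have [->|nz] := eqVneq (prunedEntry R k n Z i.+2 b c') 0; first by rewrite mul0r oppr0.
have [q1 [v1' E1 q1Z]] := prunedEntry_neq0 nz.
rewrite E1 prunedEntry_edel // (negPf q1Z) -mulrA var_pterm sign_pterm -E1.
rewrite -pterm_opp.
apply: IH => //.
- by rewrite fdeg_fplus cards1 -fd -Ef fdeg_fplus cards1.
- by rewrite msupp_fplus subUset sub1set inE q1Z; case: sf' => ->.
move=> q2 c2 f2 mc2 tq2 qF2 v2 Ec2 Ef2.
have q1G : q1 \in G by rewrite inE.
(* If they were equal, [c2] would toggle the same edge over the same monomial, and the face [b]
   would be [c]. *)
have ne2 : c' != c2.
  apply: contra ne => /eqP E; subst c2.
  have Eq : q1 = q2 by apply: (edel_inj v1' v2); rewrite -E1 Ec2.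
  have Ef' : f2 = f' by rewrite -(fplusK [set q2] f2) Ef2 Eq fplusK.
  by move: tq2; rewrite Ef' tq => -[Eqq]; rewrite E1 Eq -Eqq Ec.
have := rankAt_decr mc2 mc' tq2 qF2 tq qF v1' q1G (etrans (esym E1) (esym Ec2)) (esym Ef2) ne2.
have := rankAt_lt G c' (ltnW f'd); move: lt.
move: (rankAt G c' f') (rankAt G c2 f2) (rankAt_bound k n d) => x y z; clear; lia.
Qed.

Lemma reducible_vecT i v : vecT R k n Z v -> reducible i v.
Proof.
move=> Tv; apply: reducible_split => c cS.
apply: (pterm_ind (p := v c) (P := fun p => reducible i (single c p))).
- by apply: reducible_ext (reducible0 i) => b _; rewrite /single if_same.
- move=> p p' Rp Rp'; apply: reducible_ext (reducibleD Rp Rp') => b _.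
  by rewrite /single; case: ifP; rewrite ?addr0.
move=> f nz; have sf : msupp f \subset G.
  by apply: contraNT nz => nsf; have /inTP/(_ f nsf)-> := Tv c.
apply: (reducible_term (d := fdeg f) (N := (rankAt_bound k n (fdeg f)).+1)) => // *.
by rewrite ltnS leq_subr.
Qed.

Lemma papply_papply i w b : b \in Surv i -> papply i.+1 (papply i.+2 w) b = 0.
Proof.
move=> bS; rewrite /prunedApply.
under eq_bigr do rewrite mulr_sumr.
rewrite exchange_big big1 //= => c' c'S.
under eq_bigr do rewrite mulrA.
by rewrite -mulr_suml pruned_dd // mul0r.
Qed.

(** After elimination the difference is still a cycle, now without lower coefficients, hence
    zero. *)
Lemma pruned_exact i v : vecT R k n Z v ->
  (forall b, b \in Surv i -> papply i.+1 v b = 0) ->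
  exists w, vecT R k n Z w /\ forall c, c \in Surv i.+1 -> papply i.+2 w c = v c.
Proof.
move=> Tv cyc; have [w [Tw H]] := reducible_vecT i Tv.
exists w; split=> // c cS; apply/esym/eqP; rewrite -subr_eq0; apply/eqP.
have cyc' b : b \in Surv i -> papply i.+1 (fun c => v c - papply i.+2 w c) b = 0.
  by move=> bS; rewrite papplyB cyc // papply_papply // subr0.
case: i => [|i] in cyc cyc' H cS *.
  by apply: (cycle_no_lower1 (v := fun c => v c - papply 2 w c)) => //; apply: cyc'; rewrite set11.
exact: (cycle_no_lower (v := fun c => v c - papply i.+3 w c) H cyc').
Qed.

(** A matching in this degree would occupy [n + 1] columns. *)
Lemma surv_overflow c : (k <= n)%N -> c \in Surv (n - k).+2 -> False.
Proof.
move=> kn cS; have mc := surv_matchable cS; have [mF _] := optMatP mc.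
have := surv_card cS; rewrite (isMat_card mF).2.
have := max_card (mem c.2); rewrite card_ord; move: #|c.2| => a; lia.
Qed.

(** * The ideal of minors and minimality *)

Lemma zeroZ_maxMinor (J : {set 'I_n}) : zeroZ R k n Z (maxMinor A k n (genX R k n) J) =
  maxMinor A k n (map_mx (zeroZ R k n Z) (genX R k n)) J.
Proof.
rewrite /maxMinor -det_map_mx; congr (\det _); apply/matrixP => a b; rewrite !mxE.
elim: (enum J) (nat_of_ord b) => [|x s IH] [|i] //=; rewrite ?raddf0 //; last exact: IH.
by rewrite !mxE.
Qed.


Definition minorBasis (J : {set 'I_n}) : ENbasis k n := ((ENb0 k n).1, J).

(** Pruning in degree 1 only drops minors that become zero, so the sum may run over all [J]. *)
Lemma papply1E w : papply 1 w (ENb0 k n) = \sum_(J : {set 'I_n} | #|J| == k)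
  w (minorBasis J) * maxMinor A k n (map_mx (zeroZ R k n Z) (genX R k n)) J.
Proof.
rewrite /prunedApply.
rewrite (eq_bigl (fun c => inENbasis k n 1 c && (c \in Surv 1))); last first.
  by move=> c; rewrite survE; case: inENbasis.
rewrite big_mkcondr (reindex_onto minorBasis (fun c => c.2)) /=; last first.
  move=> c /andP[s0 _]; rewrite [RHS]surjective_pairing; congr pair.
  apply/ffunP => r; rewrite ffunE; apply: ord_inj => /=.
  by move: s0; rewrite sum_nat_eq0 => /forallP/(_ r)/eqP.
have minorB J : inENbasis k n 1 (minorBasis J) = (#|J| == k).
  by rewrite /inENbasis big1 ?addn0 // => r _; rewrite ffunE.
apply: eq_big => [J|J /andP[Jk _]]; first by rewrite eqxx andbT -minorB.
rewrite -zeroZ_maxMinor mulrC -/(prunedEntry R k n Z 1 (ENb0 k n) (minorBasis J)).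
case: ifP => // /negbT; apply: contraNeq => nz; rewrite inE; apply/andP; split=> //.
apply/existsP; exists (ENb0 k n); rewrite set11 /=.
by apply: contraNneq nz => E; rewrite /prunedEntry /= E mulr0.
Qed.

Lemma pcoef_constTerm (p : A) f :
  pcoef (constTerm R k n p) f = if msupp f == set0 then pcoef p f else 0.
Proof.
rewrite /pcoef /constTerm mcoef_zeroVars all_iota_eidx; congr (if _ then _ else _).
apply/forallP/eqP => [H|/setP E q]; last first.
  by rewrite toexpE; have := E q; rewrite !inE lt0n => /negbFE.
by apply/setP => q; rewrite !inE; have := H q; rewrite toexpE /= => /eqP->.
Qed.

(** Each monomial of a minor has [k > 0] factors, and the nonzero entries in higher degrees are
    signed variables. *)
Lemma prunedEntry_minimal i b c : (0 < k)%N -> c \in Surv i.+1 ->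
  constTerm R k n (prunedEntry R k n Z i.+1 b c) = 0.
Proof.
move=> k0 cS; apply: pcoef_ext => f; rewrite pcoef_constTerm pcoef0; case: eqP => // f0.
case: i cS => [|i] cS.
  have [c1 c2] := level1 cS; have [sg H] := pcoef_minor R Z c1 c2.
  have := H 1 f; rewrite mulr1 => ->; rewrite big1 // => F /andP[mF].
  rewrite f0 subset0 => /eqP F0; have [E _] := isMat_card mF.
  by move: E; rewrite F0 cards0; lia.
have [->|/prunedEntry_neq0[q [vq -> qZ]]] := eqVneq (prunedEntry R k n Z i.+2 b c) 0.
  exact: pcoef0.
rewrite -[prunedEntry _ _ _ _ _ _ _]mulr1 pcoef_entry_edel ?inE //.
have := in_set0 q; rewrite -f0 inE => ->; exact: mulr0.
Qed.

Theorem prunedEN_minimal_resolution : (1 <= k <= n)%N -> prunedENisMinRes R k n Z.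
Proof.
move=> /andP[k0 kn]; split; [|split; [|split]].
- move=> [|i] // _ v Tv; split=> [cyc|[w [Tw Ew]] r rS]; first exact: pruned_exact.
  rewrite /= in rS; rewrite -(papply_papply w rS) /prunedApply.
  by apply: eq_bigr => c cS; rewrite -Ew.
(* Injectivity at the top is exactness there, since no basis element survives in the next degree. *)
- move=> v Tv cyc c cS; have [w [_ Ew]] := pruned_exact Tv cyc.
  rewrite -Ew // /prunedApply big1 // => c' c'S.
  by case: (surv_overflow kn c'S).
- move=> p Tp; split=> [[w [Tw Ew]]|[cf [Tcf Ep]]].
    by exists (fun J => w (minorBasis J)); split=> //; rewrite -Ew papply1E.
  by exists (fun c => cf c.2); split=> //; rewrite papply1E Ep.
- move=> [|i] // _ r c rS cS; exact: prunedEntry_minimal.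
Qed.

End Exactness.

Theorem mainTheorem7 (k n : nat) (Z : {set 'I_k * 'I_n}) :
  (1 <= k <= n)%N ->
  (forall K : fieldType, prunedENisMinRes K k n Z) /\ prunedENisMinRes int k n Z.
Proof. by move=> kn; split=> [K|]; apply: prunedEN_minimal_resolution. Qed.
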